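(* Let $A,B,B_0>0$ and $\alpha>\beta>1$, let $N\ge 2$, and let $U$ be the magnetic-repulsive energy of $N$ particles defined in the context. For $P=(p_0,\dots,p_{N-1})\in\mathbb{R}^N$ with $p_0<p_1<\dots<p_{N-1}$ let $\mathfrak{S}_P$ be the spear configuration defined in the context. (i) There exists $P_0\in\mathbb{R}^N$ (with strictly increasing coordinates) such that $\mathfrak{S}_{P_0}$ is a critical point of $U$ in $(\mathbb{R}^3\times\mathbb{S}^2)^N$, and $P_0$ is a minimizer of the problem $\inf_{P}U(\mathfrak{S}_P)$, the infimum being over all $P\in\mathbb{R}^N$ with $p_0<\dots<p_{N-1}$. (ii) For any critical point of $U$ of the form $\mathfrak{S}_P$, with positions $x_k=(p_k,0,0)$, one has for all $k=1,\dots,N-1$: $$\check h\le |x_{k-1}-x_k|\le \hat h .$$ (iii) Assume moreover $\beta\ge 3$. Then there exists $\alpha_*=\alpha_*(\beta)$, independent of $N$, such that if $\alpha>\alpha_*$, then $P_0$ is unique up to translation: any two $P$ with strictly increasing coordinates for which $\mathfrak{S}_P$ is a critical point of $U$ differ by a vector $(\lambda,\dots,\lambda)$, $\lambda\in\mathbb{R}$. Moreover (for $\alpha>\alpha_*$) there exist positive constants $c$ and $C$, independent of $N$, such that the positions $x_k$ of the spear $\mathfrak{S}_{P_0}$ satisfy for all $k=1,\dots,N-1$: $$\bar h+\frac{c}{N^{\beta-1}}\le |x_{k-1}-x_k|\le \bar h+C\left(\frac{1}{N^{\beta-1}}+\frac{1}{k^{\beta-1}}+\frac{1}{(N-k)^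{\beta-1}}\right).$$
   Context: A configuration of $N$ magnetic particles is $(X,M)=((x_0,m_0),\dots,(x_{N-1},m_{N-1}))\in(\mathbb{R}^3\times\mathbb{S}^2)^N$ with pairwise distinct positions $x_k$. Put $r_{k\ell}=x_k-x_\ell$. The energy is $$U(X,M)=\sum_{k}\sum_{\ell<k}\left(B_0\frac{m_k\cdot m_\ell}{|r_{k\ell}|^{\beta}}-(B+B_0)\frac{(m_k\cdot r_{k\ell})(m_\ell\cdot r_{k\ell})}{|r_{k\ell}|^{\beta+2}}+\frac{A}{|r_{k\ell}|^{\alpha}}\right),$$ with fixed parameters $A,B,B_0,\alpha,\beta>0$. Critical points of $U$ in $(\mathbb{R}^3\times\mathbb{S}^2)^N$ are critical points of $U$ as a function on the open subset of this manifold where positions are pairwise distinct (so each $m_k$ varies on the unit sphere). For $P=(p_0,\dots,p_{N-1})\in\mathbb{R}^N$ with $p_0<\dots<p_{N-1}$, the spear $\mathfrak{S}_P$ is the configuration $x_k=(p_k,0,0)$, $m_k=(1,0,0)$ for $0\le k\le N-1$. With $\zeta(s)=\sum_{n\ge1}n^{-s}$, $$\check h=\left(\frac{\alpha A}{\beta B\zeta(\beta)}\right)^{\frac1{\alpha-\beta}},\quad \bar h=\left(\frac{\alpha A\zeta(\alpha)}{\beta B\zeta(\beta)}\right)^{\frac1{\alpha-\beta}},\quad \hat h=\left(\frac{\alpha A}{\beta B}\right)^{\frac1{\alpha-\beta}}.$$ *)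

(* Defs.v *)
From HB Require Import structures.
From mathcomp Require Import all_boot all_order all_algebra.
From mathcomp Require Import all_classical all_reals all_analysis.
Set Implicit Arguments.
Unset Strict Implicit.
Unset Printing Implicit Defensive.
Import Order.TTheory GRing.Theory Num.Theory.
Import numFieldNormedType.Exports.
Local Open Scope classical_set_scope.
Local Open Scope ring_scope.

Definition dot (R : realType) (u v : 'rV[R]_3) : R := \sum_i u 0 i * v 0 i.

(* The library norm [`|u|] on row vectors is the max-norm, hence this one. *)
Definition enorm (R : realType) (u : 'rV[R]_3) : R := Num.sqrt (dot u u).

Definition pair_energy (R : realType) (A B B0 alpha beta : R)
    (r m m' : 'rV[R]_3) : R :=
  B0 * (dot m m' / enorm r `^ beta)
  - (B + B0) * (dot m r * dot m' r / enorm r `^ (beta + 2))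
  + A / enorm r `^ alpha.

Definition energy (R : realType) (A B B0 alpha beta : R) (N : nat)
    (X M : 'I_N -> 'rV[R]_3) : R :=
  \sum_(k < N) \sum_(l < N | (l < k)%N)
    pair_energy A B B0 alpha beta (X k - X l) (M k) (M l).

Definition configuration (R : realType) (N : nat)
    (X M : 'I_N -> 'rV[R]_3) : Prop :=
  injective X /\ forall k, enorm (M k) = 1.

(* Criticality on the open subset of distinct positions of the manifold
   (R^3 x S^2)^N. The tangent vectors at (X, M) are the velocities of the curves
   through (X, M) that stay in the manifold, and the differential of U on such a
   velocity is the derivative of U along the curve: it has to exist and to
   vanish. *)
Definition critical_point (R : realType) (N : nat)
    (U : ('I_N -> 'rV[R]_3) -> ('I_N -> 'rV[R]_3) -> R)
    (X M : 'I_N -> 'rV[R]_3) : Prop :=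
  configuration X M /\
  forall Xt Mt : R -> 'I_N -> 'rV[R]_3,
    Xt 0 = X -> Mt 0 = M ->
    (\forall t \near (0 : R), configuration (Xt t) (Mt t)) ->
    (forall k, derivable (fun t : R => Xt t k) 0 1 /\
               derivable (fun t : R => Mt t k) 0 1) ->
    is_derive (0 : R) (1 : R) (fun t : R => U (Xt t) (Mt t)) (0 : R).

Definition increasing_coords (R : realType) (N : nat) (P : 'rV[R]_N) : Prop :=
  forall i j : 'I_N, (i < j)%N -> P 0 i < P 0 j.

Definition spear_pos (R : realType) (N : nat) (P : 'rV[R]_N) (k : 'I_N)
  : 'rV[R]_3 := P 0 k *: delta_mx 0 0.

Definition spear_mom (R : realType) (N : nat) (k : 'I_N) : 'rV[R]_3 :=
  delta_mx 0 0.

Definition spear_energy (R : realType) (A B B0 alpha beta : R) (N : nat)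
    (P : 'rV[R]_N) : R :=
  energy A B B0 alpha beta (spear_pos P) (@spear_mom R N).

Definition critical_spear (R : realType) (A B B0 alpha beta : R) (N : nat)
    (P : 'rV[R]_N) : Prop :=
  increasing_coords P /\
  critical_point (@energy R A B B0 alpha beta N) (spear_pos P) (@spear_mom R N).

Definition minimizing_spear (R : realType) (A B B0 alpha beta : R) (N : nat)
    (P : 'rV[R]_N) : Prop :=
  increasing_coords P /\
  forall Q : 'rV[R]_N, increasing_coords Q ->
    spear_energy A B B0 alpha beta P <= spear_energy A B B0 alpha beta Q.

(* [riemannR s n] is 1 / (n + 1) ^ s; the series converges for s > 1. *)
Definition zeta (R : realType) (s : R) : R := limn (series (riemannR s)).

Definition h_check (R : realType) (A B alpha beta : R) : R :=
  ((alpha * A) / (beta * B * zeta beta)) `^ (1 / (alpha - beta)).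

Definition h_bar (R : realType) (A B alpha beta : R) : R :=
  ((alpha * A * zeta alpha) / (beta * B * zeta beta)) `^ (1 / (alpha - beta)).

Definition h_hat (R : realType) (A B alpha beta : R) : R :=
  ((alpha * A) / (beta * B)) `^ (1 / (alpha - beta)).

(* Main.v *)
(** On the spear every transverse or rotational first variation vanishes by
    symmetry, so criticality is the balance of the one-dimensional forces
    [beta B r^(-beta-1) - alpha A r^(-alpha-1)].  Testing it with the indicator of
    a half-line gives one equation per gap: the forces between the two sides of
    the gap add up to zero.  After rescaling by [h_hat] the force is negative only
    on (0, 1), which bounds the gaps by 1; applied to the smallest gap the same
    equation gives the bound [h_check].  A minimizer exists because shrinking the
    gaps above [h_hat] lowers the energy, which leaves a compact set of gaps.

    For large [alpha] the force is stiff between neighbours, with slope at least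
    [alpha + 1 - (beta + 1) zeta beta], while the other pairs contribute Lipschitz
    constants that are summable uniformly in [N]; beyond [2 h_check] the force
    decreases.  So in the difference of the gap equations of two chains, taken at
    the gap where the chains differ most, the neighbours dominate.  For two
    equilibria this forces equal gaps.  For an equilibrium and the uniform chain of
    spacing [h_bar], with differences measured relative to
    [k^(1-beta) + (N-k)^(1-beta)], it gives the upper bound; there [beta >= 3]
    makes the sums of these weights over the windows converge.  For the lower
    bound, the smallest gap is compared with the uniform infinite chain, from which
    a tail of order [N^(1-beta)] is missing. *)
Require Import Defs.
From HB Require Import structures.
From mathcomp Require Import all_boot all_order all_algebra.
From mathcomp Require Import all_classical all_reals all_analysis.
From mathcomp Require Import ring lra zify.
Import Order.TTheory GRing.Theory Num.Theory.
Import numFieldNormedType.Exports.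
Local Open Scope ring_scope.
Set Implicit Arguments.
Unset Strict Implicit.
Unset Printing Implicit Defensive.

(** * Convexity and monotonicity of real powers *)

Section PowR.
Context {R : realType}.
Implicit Types x y u p q s : R.

Lemma powRD_gt0 x p q : 0 < x -> x `^ (p + q) = x `^ p * x `^ q.
Proof. by move=> x0; rewrite powRD// (gt_eqF x0) implybT. Qed.

Lemma powRMN x p : 0 < x -> x `^ p * x `^ (- p) = 1.
Proof. by move=> x0; rewrite -powRD_gt0// subrr powRr0. Qed.

(** For p <= 0 write u^p = exp (p ln u) and use exp x >= 1 + x with ln u <= u - 1. The case p >= 1
    reduces to it through u^p = u (1/u)^(1-p). *)
Lemma bernoulli_powR u p : 0 < u -> (p <= 0) || (1 <= p) ->
  1 + p * (u - 1) <= u `^ p.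
Proof.
have neg (v r : R) : 0 < v -> r <= 0 -> 1 + r * (v - 1) <= v `^ r.
  move=> v0 r0; rewrite /powR gt_eqF//; apply: le_trans (expR_ge1Dx _).
  have := @le_ln1Dx _ (v - 1); rewrite addrCA subrr addr0 => lnv.
  by rewrite lerD2l ler_wnM2l// lnv//; lra.
move=> u0 /orP[p0|p1]; first exact: neg.
have ui0 : 0 < u^-1 by rewrite invr_gt0.
have h := neg u^-1 (1 - p) ui0 ltac:(lra).
have -> : u `^ p = u * u^-1 `^ (1 - p).
  rewrite -(powR_inv1 (ltW u0)) -powRrM -[in X in X * _](powRr1 (ltW u0)).
  by rewrite -powRD_gt0//; congr powR; ring.
apply: le_trans (ler_wpM2l (ltW u0) h).
have -> : u * (1 + (1 - p) * (u^-1 - 1)) = 1 + p * (u - 1); last by [].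
by field; rewrite gt_eqF.
Qed.

(** Bernoulli's inequality rescaled to x / y. All later convexity estimates, for forces, potentials
    and zeta tails, are instances of this tangent bound. *)
Lemma powR_tangent x y p : 0 < x -> 0 < y -> (p <= 0) || (1 <= p) ->
  y `^ p + p * y `^ (p - 1) * (x - y) <= x `^ p.
Proof.
move=> x0 y0 hp.
have xy0 : 0 < x / y by rewrite divr_gt0.
have -> : x `^ p = y `^ p * (x / y) `^ p.
  by rewrite -(powRM _ (ltW y0) (ltW xy0)) mulrC divfK// gt_eqF.
apply: le_trans (ler_wpM2l (powR_ge0 _ _) (bernoulli_powR xy0 hp)).
rewrite powRD_gt0// (powR_inv1 (ltW y0)).
have -> : y `^ p * (1 + p * (x / y - 1)) =
  y `^ p + p * (y `^ p * y^-1) * (x - y); last by [].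
by field; rewrite gt_eqF.
Qed.

Lemma powRN_tangent x y p : 0 < x -> 0 < y -> 0 <= p ->
  y `^ (- p) - p * y `^ (- (p + 1)) * (x - y) <= x `^ (- p).
Proof.
move=> x0 y0 p0; have := @powR_tangent x y (- p) x0 y0.
rewrite oppr_le0 p0 => /(_ isT); rewrite opprD.
by rewrite !mulNr.
Qed.

Lemma ler_powRN x y p : 0 < x -> x <= y -> 0 <= p -> y `^ (- p) <= x `^ (- p).
Proof.
move=> x0 xy p0; have y0 := lt_le_trans x0 xy.
apply: le_trans (powRN_tangent x0 y0 p0).
have : 0 <= p * y `^ (- (p + 1)) by rewrite mulr_ge0// powR_ge0.
nra.
Qed.

Lemma ltr_powRN x y p : 0 < x -> x < y -> 0 < p -> y `^ (- p) < x `^ (- p).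
Proof.
move=> x0 xy p0; have y0 := lt_trans x0 xy.
apply: lt_le_trans (powRN_tangent x0 y0 (ltW p0)).
have : 0 < p * y `^ (- (p + 1)) by rewrite mulr_gt0// powR_gt0.
nra.
Qed.

Lemma powR1E p : (1 : R) `^ p = 1. Proof. by rewrite powR1. Qed.

Lemma powR_le1 x p : 0 < x -> x <= 1 -> 0 <= p -> x `^ p <= 1.
Proof.
move=> x0 x1 p0; rewrite -[leRHS](powR1E p); apply: ge0_ler_powR => //.
- by rewrite nnegrE ltW.
- by rewrite nnegrE.
Qed.

Lemma powRN_ge1 x p : 0 < x -> x <= 1 -> 0 <= p -> 1 <= x `^ (- p).
Proof.
by move=> x0 x1 p0; rewrite -[leLHS](powR1E (- p)); apply: ler_powRN.
Qed.


(** * Partial sums and tails of the zeta series *)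

Definition zeta_sum s m : R := \sum_(0 <= n < m) n.+1%:R `^ (- s).

Lemma zeta_sumS s m : zeta_sum s m.+1 = zeta_sum s m + m.+1%:R `^ (- s).
Proof. by rewrite /zeta_sum big_nat_recr. Qed.

Lemma zeta_sum_cat s m n : (m <= n)%N ->
  zeta_sum s n = zeta_sum s m + \sum_(m <= i < n) i.+1%:R `^ (- s).
Proof. by move=> mn; rewrite /zeta_sum (big_cat_nat (n := m)). Qed.

Lemma zeta_sum_nondecreasing s : {homo zeta_sum s : m n / (m <= n)%N >-> m <= n}.
Proof.
by move=> m n mn; rewrite (zeta_sum_cat s mn) lerDl sumr_ge0.
Qed.

(* By convexity (n+1)^(-s) is at most (n^(1-s) - (n+1)^(1-s)) / (s - 1), and these
   bounds telescope. *)
Lemma zeta_sum_tail s m n : 1 < s -> (0 < m)%N -> (m <= n)%N ->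
  zeta_sum s n <= zeta_sum s m + m%:R `^ (1 - s) / (s - 1).
Proof.
move=> s1 m0 mn.
suff: zeta_sum s n + n%:R `^ (1 - s) / (s - 1) <=
      zeta_sum s m + m%:R `^ (1 - s) / (s - 1).
  by apply: le_trans; rewrite lerDl divr_ge0 ?powR_ge0//; lra.
elim: n mn => [|n IH]; first by rewrite leqn0 => /eqP ->.
rewrite leq_eqVlt => /orP[/eqP <-//|]; rewrite ltnS => mn.
apply: le_trans (IH mn); rewrite zeta_sumS.
have n0 : (0 : R) < n%:R by rewrite ltr0n (leq_trans m0).
have n10 : (0 : R) < n.+1%:R by rewrite ltr0n.
have := @powRN_tangent n%:R n.+1%:R (s - 1) n0 n10 ltac:(lra).
rewrite subrK opprB -natr1 => h.
rewrite -addrA lerD2l -(ler_pM2r (_ : 0 < s - 1)) ?subr_gt0//.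
rewrite mulrDl !divfK ?subr_eq0 ?gt_eqF//.
by apply: le_trans h; rewrite le_eqVlt; apply/orP; left; apply/eqP; ring.
Qed.

Lemma is_cvg_zeta_sum s : 1 < s -> cvgn (zeta_sum s).
Proof.
move=> s1; apply: nondecreasing_is_cvgn; first exact: zeta_sum_nondecreasing.
exists (zeta_sum s 1 + 1%:R `^ (1 - s) / (s - 1)) => _ [n _ <-].
case: n => [|n]; last exact: zeta_sum_tail.
rewrite {1}/zeta_sum big_geq// addr_ge0// ?divr_ge0 ?powR_ge0//; last lra.
by rewrite sumr_ge0// => i _; exact: powR_ge0.
Qed.

Lemma zetaE s : zeta s = limn (zeta_sum s).
Proof.
rewrite /zeta; congr (limn _); apply/funext => n; rewrite /series/= /zeta_sum.
by apply: eq_bigr => i _; rewrite powRN.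
Qed.

Lemma zeta_sum_le_zeta s m : 1 < s -> zeta_sum s m <= zeta s.
Proof.
move=> s1; rewrite zetaE; apply: nondecreasing_cvgn_le.
  exact: zeta_sum_nondecreasing.
exact: is_cvg_zeta_sum.
Qed.

Lemma zeta_le_tail s m : 1 < s -> (0 < m)%N ->
  zeta s <= zeta_sum s m + m%:R `^ (1 - s) / (s - 1).
Proof.
move=> s1 m0; rewrite zetaE; apply: limr_le; first exact: is_cvg_zeta_sum.
by exists m => // n mn; exact: zeta_sum_tail.
Qed.

Lemma zeta_ge1 s : 1 < s -> 1 <= zeta s.
Proof.
move=> s1; apply: le_trans (zeta_sum_le_zeta 1 s1).
by rewrite /zeta_sum big_nat1 powR1.
Qed.

Lemma zeta_gt0 s : 1 < s -> 0 < zeta s.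
Proof. by move=> /zeta_ge1; exact: lt_le_trans. Qed.


End PowR.

(** * Double sums over the pairs separated by a gap *)

Section DoubleSums.
Context {R : realType}.
Implicit Types (G H : nat -> nat -> R) (phi : nat -> R).

(** The corner is the pair of neighbours bounding the gap, which obeys a different estimate from all
    other pairs. Adding the corner terms crosswise takes it out of the comparison without splitting
    the sums. *)
Lemma ler_sum2_corner G H s t : (0 < s)%N -> (0 < t)%N ->
  (forall i j, (i < s)%N -> (j < t)%N -> (0 < i + j)%N -> G i j <= H i j) ->
  \sum_(i < s) \sum_(j < t) G i j + H 0%N 0%N <=
  \sum_(i < s) \sum_(j < t) H i j + G 0%N 0%N.
Proof.
case: s t => [|s] [|t]// _ _ GH.
rewrite !big_ord_recl/=.
have h1 : \sum_(i < t) G 0%N (bump 0 i) <= \sum_(i < t) H 0%N (bump 0 i).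
  by apply: ler_sum => j _; exact: (GH 0%N j.+1 isT (ltn_ord j) isT).
have h2 : \sum_(i < s) \sum_(j < t.+1) G (bump 0 i) j <=
          \sum_(i < s) \sum_(j < t.+1) H (bump 0 i) j.
  apply: ler_sum => i _; apply: ler_sum => j _.
  exact: (GH i.+1 j (ltn_ord i) (ltn_ord j) isT).
lra.
Qed.

Lemma sumr_leq_indic n s :
  \sum_(i < s) ((i <= n)%N%:R : R) = (minn s n.+1)%:R.
Proof.
elim: s => [|s IH]; first by rewrite big_ord0 min0n.
rewrite big_ord_recr/= IH -natrD; congr (_%:R); lia.
Qed.

Lemma sum_shift_indic phi i m : (i <= m)%N ->
  \sum_(j < m - i) phi (i + j)%N = \sum_(n < m) (i <= n)%N%:R * phi n.
Proof.
move=> im.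
rewrite -(big_mkord predT (fun j => phi (i + j)%N)).
rewrite -(big_mkord predT (fun n => (i <= n)%N%:R * phi n)).
rewrite [RHS](big_cat_nat (n := i))//= [X in _ = X + _]big_nat_cond.
rewrite [X in _ = X + _]big1 ?add0r; last first.
  by move=> n /andP[/andP[_ ni] _]; rewrite leqNgt ni mul0r.
have := big_addn 0 m i xpredT (fun n => (i <= n)%N%:R * phi n : R).
rewrite add0n => ->; apply: eq_bigr => n _.
by rewrite leq_addl mul1r addnC.
Qed.

(** The equation i + j = n has at most n + 1 solutions in the rectangle, and none once n >= s +
    t. *)
Lemma sum_square_le phi s t : (forall n, 0 <= phi n) ->
  \sum_(i < s) \sum_(j < t) phi (i + j)%N <= \sum_(n < s + t) n.+1%:R * phi n.
Proof.
move=> phi0.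
apply: (@le_trans _ _ (\sum_(i < s) \sum_(n < s + t) (i <= n)%N%:R * phi n)).
  apply: ler_sum => i _.
  have iN : (i <= s + t)%N by rewrite (leq_trans (ltnW (ltn_ord i))) ?leq_addr.
  rewrite -sum_shift_indic//.
  have ht : (t <= s + t - i)%N by have := ltn_ord i; lia.
  rewrite (big_ord_widen _ (fun j => phi (i + j)%N) ht) [leLHS]big_mkcond/=.
  by apply: ler_sum => j _; case: ifP.
rewrite exchange_big/=; apply: ler_sum => n _.
by rewrite -mulr_suml sumr_leq_indic ler_wpM2r// ler_nat geq_minr.
Qed.

(** The value [phi 0] may have any sign because it occurs exactly once on each side. This matters
    for forces, which are negative between close neighbours. *)
Lemma sum_square_le_corner phi s t : (0 < s)%N -> (0 < t)%N ->
  (forall n, (0 < n)%N -> 0 <= phi n) ->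
  \sum_(i < s) \sum_(j < t) phi (i + j)%N <= \sum_(n < s + t) n.+1%:R * phi n.
Proof.
move=> s0 t0 phi0; pose psi n := if n == 0%N then 0 else phi n.
have psi0 n : 0 <= psi n by rewrite /psi; case: eqP => // /eqP; rewrite -lt0n => /phi0.
have h2 := sum_square_le s t psi0.
have := @ler_sum2_corner (fun i j => phi (i + j)%N) (fun i j => psi (i + j)%N) s t s0 t0.
have -> : psi (0 + 0)%N = 0 by [].
rewrite addr0 => h1.
have {}h1 : \sum_(i < s) \sum_(j < t) phi (i + j)%N <=
    \sum_(i < s) \sum_(j < t) psi (i + j)%N + phi 0%N.
  by apply: h1 => i j _ _ ij0; rewrite /psi gtn_eqF.
 apply: le_trans h1 _.
case: s s0 h2 => // s _ h2; rewrite !addSn in h2 *.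
rewrite [leRHS]big_ord_recl/= mul1r addrC lerD2l; apply: le_trans h2 _.
by rewrite big_ord_recl/= /psi/= mulr0 add0r.
Qed.

(** For n < m all n + 1 solutions of i + j = n fit into the rectangle. *)
Lemma sum_square_ge phi s t m : (forall n, 0 <= phi n) ->
  (m <= s)%N -> (m <= t)%N ->
  \sum_(n < m) n.+1%:R * phi n <= \sum_(i < s) \sum_(j < t) phi (i + j)%N.
Proof.
move=> phi0 ms mt.
have -> : \sum_(n < m) n.+1%:R * phi n =
    \sum_(i < m) \sum_(n < m) (i <= n)%N%:R * phi n.
  rewrite exchange_big/=; apply: eq_bigr => n _.
  by rewrite -mulr_suml sumr_leq_indic (minn_idPr _).
rewrite (big_ord_widen _ (fun i => \sum_(n < m) (i <= n)%N%:R * phi n) ms).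
rewrite big_mkcond/=; apply: ler_sum => i _; case: ifP => im; last exact: sumr_ge0.
rewrite -sum_shift_indic 1?ltnW//.
have ht : (m - i <= t)%N by rewrite (leq_trans (leq_subr _ _)).
rewrite (big_ord_widen _ (fun j => phi (i + j)%N) ht) [leLHS]big_mkcond/=.
by apply: ler_sum => j _; case: ifP.
Qed.

Lemma exists_argmin (u : nat -> R) n : (0 < n)%N ->
  exists2 l, (l < n)%N & forall m, (m < n)%N -> u l <= u m.
Proof.
case: n => // n _; case: (@arg_minP _ _ _ (@ord0 n) xpredT (fun i => u i)) => // i _ imin.
by exists i => // m mn; exact: (imin (Ordinal mn)).
Qed.

End DoubleSums.

Ltac nat_lia :=
  try match goal with R : realType |- _ => clear dependent R end; lia.

(** * Equilibrium chains on a line and their gap equations *)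

Section Chains.
Context {R : realType}.
Implicit Types (F : R -> R) (p v : nat -> R) (N l : nat).

(** Force balance in weak form: the first variation vanishes for every displacement [v] of the
    particles. *)
Definition equilibrium F N p := forall v,
  \sum_(k < N) \sum_(j < N | (j < k)%N) F (p k - p j) * (v k - v j) = 0.

Definition gap p l := p l.+1 - p l.

(* Distance from the i-th particle left of the l-th gap to the j-th one right of
   it; when l + 1 < N these pairs, with i <= l and j < N - (l + 1), are those
   separated by that gap. *)
Definition across p l i j := p (l.+1 + j)%N - p (l - i)%N.

Lemma across00 p l : across p l 0 0 = gap p l.
Proof. by rewrite /across addn0 subn0. Qed.

Lemma cut_equation F N p l : equilibrium F N p -> (l.+1 < N)%N ->
  \sum_(i < l.+1) \sum_(j < N - l.+1) F (across p l i j) = 0.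
Proof.
move=> /(_ (fun n => (l < n)%N%:R)) eqF lN.
rewrite exchange_big/= -[RHS]eqF.
rewrite -(big_mkord xpredT (fun j => \sum_(i < l.+1) F (across p l i j))).
rewrite -(big_mkord xpredT (fun k => \sum_(j < N | (j < k)%N)
  F (p k - p j) * ((l < k)%N%:R - (l < j)%N%:R))).
rewrite [RHS](big_cat_nat (n := l.+1))//=; last exact: ltnW.
rewrite [X in _ = X + _]big_nat_cond [X in _ = X + _]big1 ?add0r; last first.
  move=> k /andP[/andP[_ kl] _]; rewrite big1// => j jk.
  by rewrite !ltnNge -ltnS kl (leq_trans (ltnW jk)) ?subrr ?mulr0.
have := big_addn 0 N l.+1 xpredT (fun k => \sum_(j < N | (j < k)%N)
  F (p k - p j) * ((l < k)%N%:R - (l < j)%N%:R)).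
rewrite add0n => ->; apply: eq_big_nat => k /andP[_ kN].
have lk : (l < k + l.+1)%N by nat_lia.
rewrite lk [RHS](bigID (fun j : 'I_N => (l < j)%N))/= [X in _ = X + _]big1 ?add0r; last first.
  by move=> j; move=> /andP[_ lj]; rewrite lj subrr mulr0.
(* Reversing the left-hand sum turns the offset from the gap into the index of the left particle, as
   in the pair sum. *)
rewrite (reindex_inj rev_ord_inj)/=.
rewrite (big_ord_widen_cond N xpredT (fun i => F (across p l (l.+1 - i.+1) k)) (ltnW lN)).
apply: eq_big => i.
  by apply/idP/idP; nat_lia.
rewrite /= ltnS => il.
by rewrite [(l < i)%N]ltnNge il/= subr0 mulr1 /across subSS subKn// [(l.+1 + k)%N]addnC.
Qed.

Lemma gap_sum p m n : (m <= n)%N -> p n - p m = \sum_(m <= l < n) gap p l.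
Proof. by move=> mn; rewrite telescope_sumr. Qed.

Lemma acrossE p l i j :
  (i <= l)%N -> across p l i j = \sum_(l - i <= m < l.+1 + j) gap p m.
Proof. by move=> il; rewrite /across gap_sum//; nat_lia. Qed.

Lemma across_ge p N c l i j : (forall m, (m.+1 < N)%N -> c <= gap p m) ->
  (i < l.+1)%N -> (j < N - l.+1)%N -> (i + j).+1%:R * c <= across p l i j.
Proof.
move=> hc il jN; rewrite acrossE//.
have -> : (i + j).+1%:R * c = \sum_(l - i <= m < l.+1 + j) c.
  by rewrite big_const_nat iter_addr_0 mulr_natl; congr (_ *+ _); nat_lia.
rewrite [leLHS]big_nat_cond [leRHS]big_nat_cond.
by apply: ler_sum => m /andP[/andP[_ mj] _]; apply: hc; nat_lia.
Qed.

End Chains.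

(** * The rescaled force and the a priori bounds on gaps *)

Section Force.
Context {R : realType}.
Implicit Types (a b x y r h : R).

(** Up to a positive factor, the derivative of the pair energy of aligned particles in units of
    [h_hat]; positive values mean attraction. *)
Definition force a b r := r `^ (- (b + 1)) - r `^ (- (a + 1)).

Lemma force_gt0 a b r (b1 : 1 < b) (ba : b < a) : 1 < r -> 0 < force a b r.
Proof.
move=> r1; have r0 : 0 < r by lra.
rewrite subr_gt0 (_ : - (a + 1) = - (b + 1) + - (a - b)); last ring.
rewrite powRD_gt0// gtr_pMr ?powR_gt0//.
rewrite -[ltRHS](powR1E (- (a - b))); apply: ltr_powRN => //; lra.
Qed.

(** Only the attractive term can decrease, and by convexity it drops at most at the rate of its
    slope at x. *)
Lemma force_lip a b x y (b1 : 1 < b) (ba : b < a) : 0 < x -> x <= y ->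
  - ((b + 1) * x `^ (- (b + 2)) * (y - x)) <= force a b y - force a b x.
Proof.
move=> x0 xy; have y0 : 0 < y by lra.
have := @powRN_tangent _ y x (b + 1) y0 x0 ltac:(lra).
have := @ler_powRN _ x y (a + 1) x0 xy ltac:(lra).
rewrite (_ : b + 1 + 1 = b + 2); last ring.
rewrite /force; lra.
Qed.

(** On (0, 1] the repulsive term has slope at least a + 1, read off from its tangent at y; the
    attractive term costs what it does in [force_lip]. *)
Lemma force_core a b x y (b1 : 1 < b) (ba : b < a) : 0 < x -> x <= y -> y <= 1 ->
  (a + 1 - (b + 1) * x `^ (- (b + 2))) * (y - x) <= force a b y - force a b x.
Proof.
move=> x0 xy y1; have y0 : 0 < y by lra.
have := @powRN_tangent _ y x (b + 1) y0 x0 ltac:(lra).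
have := @powRN_tangent _ x y (a + 1) x0 y0 ltac:(lra).
have := @powRN_ge1 _ y (a + 1 + 1) y0 y1 ltac:(lra).
rewrite (_ : b + 1 + 1 = b + 2); last ring.
rewrite /force; set Y := y `^ (- (a + 1 + 1)) => Y1.
have : (a + 1) * (y - x) <= (a + 1) * Y * (y - x).
  by rewrite ler_wpM2r ?ler_peMr; lra.
lra.
Qed.

(* The two powers in the force are related by t |-> t ^ s, where
   s = (a + 1) / (b + 1) > 1. *)
Lemma force_anti a b x y (b1 : 1 < b) (ba : b < a) : 0 < x -> x <= y ->
  (a + 1) / (b + 1) * x `^ (- (a - b)) <= 1 -> force a b y <= force a b x.
Proof.
move=> x0 xy hx; have y0 : 0 < y by lra.
set s := (a + 1) / (b + 1) in hx.
have s1 : 1 <= s by rewrite /s ler_pdivlMr; lra.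
have b10 : b + 1 != 0 by rewrite gt_eqF//; lra.
have := @powR_tangent _ (y `^ (- (b + 1))) (x `^ (- (b + 1))) s.
rewrite !powR_gt0// s1 orbT => /(_ isT isT isT); rewrite -!powRrM.
rewrite (_ : - (b + 1) * s = - (a + 1)); last by rewrite /s; field.
rewrite (_ : - (b + 1) * (s - 1) = - (a - b)); last by rewrite /s; field.
have := ler_powRN x0 xy (_ : 0 <= b + 1).
move=> /(_ ltac:(lra)); rewrite /force.
set X := x `^ _; set Y := y `^ _; set X' := x `^ _ in hx *.
move=> YX; have : s * X' * (X - Y) <= 1 * (X - Y) by rewrite ler_wpM2r// subr_ge0.
lra.
Qed.

Lemma natrM_powRN (s h : R) n : 0 < h ->
  n.+1%:R * (n.+1%:R * h) `^ (- (s + 1)) = h `^ (- (s + 1)) * n.+1%:R `^ (- s).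
Proof.
move=> h0; have n0 : (0 : R) < n.+1%:R by rewrite ltr0n.
rewrite powRM// ?ltW// mulrA mulrC; congr (_ * _).
rewrite -[X in X * _](powRr1 (ltW n0)) -powRD_gt0//; congr powR; ring.
Qed.

(** In an infinite chain of spacing h the distance n h occurs n times across each gap. This
    multiplicity lowers the exponent by one and is how zeta enters. *)
Lemma sum_powRN (s h : R) N : 0 < h ->
  \sum_(n < N) n.+1%:R * (n.+1%:R * h) `^ (- (s + 1)) =
  h `^ (- (s + 1)) * zeta_sum s N.
Proof.
move=> h0; rewrite /zeta_sum big_mkord mulr_sumr.
by apply: eq_bigr => n _; exact: natrM_powRN.
Qed.

Section Equilibrium.
Variables (a b : R) (N : nat) (p : nat -> R).
Hypotheses (p_inc : forall l, (l.+1 < N)%N -> 0 < gap p l)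
  (p_eq : equilibrium (force a b) N p).

(** If a gap exceeded 1, so would every distance across it, and its equation would equate a sum of
    positive forces to zero. *)
Lemma gap_le1 l (b1 : 1 < b) (ba : b < a) : (l.+1 < N)%N -> gap p l <= 1.
Proof.
move=> lN; rewrite leNgt; apply/negP => g1.
have := @ler_sum2_corner _ (fun _ _ => 0) (fun i j => force a b (across p l i j))
  l.+1 (N - l.+1)%N isT.
rewrite subn_gt0 lN (cut_equation p_eq lN) across00 big1 => [|i _]; last first.
  by rewrite big1.
rewrite !add0r leNgt (force_gt0 b1 ba)//= => /(_ isT) h; apply: notF; apply: h.
move=> i j il jN _; apply/ltW/force_gt0 => //; apply: lt_le_trans g1 _.
rewrite acrossE// (@big_cat_nat _ _ _ l)//=; [|nat_lia|nat_lia].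
rewrite [X in _ <= _ + X]big_ltn; last nat_lia.
rewrite addrCA lerDl addr_ge0//; rewrite big_nat_cond sumr_ge0// => m /andP[/andP[_ mj] _];
apply/ltW/p_inc; nat_lia.
Qed.

(** The repulsion across the smallest gap is at least that of the two neighbours, and the attraction
    is at most that of the infinite chain of spacing h. Equilibrium equates the two. *)
Lemma min_gap_ge h l (b1 : 1 < b) (ba : b < a) : (l.+1 < N)%N -> gap p l = h ->
  (forall m, (m.+1 < N)%N -> h <= gap p m) -> 1 <= zeta b * h `^ (a - b).
Proof.
move=> lN glh hmin; have h0 : 0 < h by rewrite -glh; exact: p_inc.
have h1 : \sum_(i < l.+1) \sum_(j < N - l.+1) (across p l i j) `^ (- (b + 1)) =
     \sum_(i < l.+1) \sum_(j < N - l.+1) (across p l i j) `^ (- (a + 1)).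
  apply/eqP; rewrite -subr_eq0 -sumrB; apply/eqP.
  rewrite -[RHS](cut_equation p_eq lN).
  by apply: eq_bigr => i _; rewrite -sumrB.
have h2 : h `^ (- (a + 1)) <=
    \sum_(i < l.+1) \sum_(j < N - l.+1) (across p l i j) `^ (- (a + 1)).
  have := @ler_sum2_corner _ (fun _ _ => 0) (fun i j => across p l i j `^ (- (a + 1)))
    l.+1 (N - l.+1)%N isT.
  rewrite subn_gt0 lN across00 glh big1 => [|i _]; last by rewrite big1.
  by rewrite add0r addr0; apply => // i j *; exact: powR_ge0.
have h3 : \sum_(i < l.+1) \sum_(j < N - l.+1) (across p l i j) `^ (- (b + 1)) <=
    h `^ (- (b + 1)) * zeta b.
  apply: (@le_trans _ _ (h `^ (- (b + 1)) * zeta_sum b N)); last first.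
    by rewrite ler_wpM2l ?powR_ge0// zeta_sum_le_zeta.
  rewrite -sum_powRN//.
  have := @sum_square_le _ (fun n => (n.+1%:R * h) `^ (- (b + 1))) l.+1 (N - l.+1)%N.
  rewrite subnKC ?(ltnW lN)//; move=> /(_ (fun=> powR_ge0 _ _)); apply: le_trans.
  apply: ler_sum => i _; apply: ler_sum => j _; apply: ler_powRN.
  - by rewrite mulr_gt0// ltr0n.
  - by apply: (across_ge hmin).
  - lra.
have := le_trans h2 (eq_ind _ (fun z => z <= _) h3 _ h1).
move=> h4; rewrite -(powRMN (a + 1) h0).
have -> : zeta b * h `^ (a - b) = h `^ (a + 1) * (h `^ (- (b + 1)) * zeta b).
  by rewrite mulrA -powRD_gt0// mulrC; congr (_ `^ _ * _); ring.
by rewrite ler_wpM2l// powR_ge0.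
Qed.

End Equilibrium.
End Force.

(** * Comparison of two chains across one gap *)

Section Comparison.
Context {R : realType}.
Implicit Types (a b c h q x y M : R).

(** [D] and [D'] are distances across a gap in two chains; put n = i + j + 1. The neighbours gain by
    [force_core]. Another pair loses nothing if its distance shrank, since the force decreases
    beyond 2c, and otherwise loses at most a multiple of n^(-3) M by [force_lip]. There are at most
    n pairs for each n, so the losses sum to a multiple of zeta 2. *)
Lemma comparison a b c (s t : nat) (D D' : nat -> nat -> R) M :
  1 < b -> b < a -> 0 < c -> c `^ (- (b + 2)) <= zeta b ->
  (a + 1) / (b + 1) * (2 * c) `^ (- (a - b)) <= 1 ->
  (0 < s)%N -> (0 < t)%N -> 0 <= M -> D 0 0 <= D' 0 0 -> D' 0 0 <= 1 ->
  (forall i j, (i < s)%N -> (j < t)%N -> (i + j).+1%:R * c <= D i j) ->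
  (forall i j, (i < s)%N -> (j < t)%N -> (i + j).+1%:R * c <= D' i j) ->
  (forall i j, (i < s)%N -> (j < t)%N ->
     D' i j - D i j <= (i + j).+1%:R `^ (b - 1) * M) ->
  (a + 1 - (b + 1) * zeta b) * (D' 0 0 - D 0 0) - (b + 1) * zeta b * zeta 2 * M
  <= \sum_(i < s) \sum_(j < t) force a b (D' i j)
     - \sum_(i < s) \sum_(j < t) force a b (D i j).
Proof.
move=> b1 ba c0 cb ca s0 t0 M0 D00 D'1 hD hD' hDD'.
have z0 : 0 < zeta b := zeta_gt0 b1.
set k0 := (b + 1) * zeta b; have k00 : 0 < k0 by rewrite mulr_gt0//; lra.
(* The slope (b + 1) (n c)^(-b-2) times the allowed difference n^(b-1) M, with c^(-b-2) bounded by
   zeta b. *)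
pose e i j := k0 * (i + j).+1%:R `^ (- 3) * M.
have e_ge0 i j : 0 <= e i j.
  by rewrite /e mulr_ge0// mulr_ge0 ?powR_ge0// ltW.
have corner := @ler_sum2_corner _ (fun i j => force a b (D i j) - e i j)
  (fun i j => force a b (D' i j)) s t s0 t0.
have {}corner : \sum_(i < s) \sum_(j < t) (force a b (D i j) - e i j) +
    force a b (D' 0 0) <=
    \sum_(i < s) \sum_(j < t) force a b (D' i j) + (force a b (D 0 0) - e 0%N 0%N).
  apply: corner => i j si tj ij0.
  have n0 : (0 : R) < (i + j).+1%:R by rewrite ltr0n.
  have n2 : (2 : R) <= (i + j).+1%:R by rewrite ler_nat ltnS.
  have e0 := e_ge0 i j.
  have Dge := hD i j si tj; have D'ge := hD' i j si tj.
  have nc0 : 0 < (i + j).+1%:R * c by rewrite mulr_gt0.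
  have D0 := lt_le_trans nc0 Dge; have D'0 := lt_le_trans nc0 D'ge.
  rewrite lerBlDr; have [DD'|D'D] := leP (D i j) (D' i j); last first.
    rewrite -[leLHS]addr0 lerD//; apply: (force_anti b1 ba) => //; first exact: ltW.
    apply: le_trans ca; rewrite ler_wpM2l ?divr_ge0//; try lra.
    apply: ler_powRN; [lra| |lra].
    by apply: le_trans D'ge; rewrite ler_wpM2r// ltW.
  have := force_lip b1 ba D0 DD'; suff : (b + 1) * D i j `^ (- (b + 2)) *
    (D' i j - D i j) <= e i j by lra.
  have -> : e i j = (b + 1) * ((i + j).+1%:R `^ (- (b + 2)) * zeta b) *
     ((i + j).+1%:R `^ (b - 1) * M).
    rewrite /e /k0 (_ : - 3 = - (b + 2) + (b - 1)); last ring.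
    by rewrite (@powRD_gt0 _ _ (- (b + 2)))//; ring.
  have b10 : 0 <= b + 1 by lra.
  apply: ler_pM; [by rewrite mulr_ge0 ?powR_ge0|lra| |exact: hDD'].
  rewrite ler_wpM2l//.
  have b20 : 0 <= b + 2 by lra.
  apply: le_trans (ler_powRN nc0 Dge b20) _.
  by rewrite powRM ?(ltW c0)// ler_wpM2l ?powR_ge0.
have e_le : \sum_(i < s) \sum_(j < t) e i j <= k0 * zeta 2 * M.
  have -> : \sum_(i < s) \sum_(j < t) e i j =
      (\sum_(i < s) \sum_(j < t) (i + j).+1%:R `^ (- 3)) * (k0 * M).
    rewrite mulr_suml; apply: eq_bigr => i _.
    by rewrite mulr_suml; apply: eq_bigr => j _; rewrite /e; ring.
  rewrite (_ : k0 * zeta 2 * M = zeta 2 * (k0 * M)); last ring.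
  rewrite ler_wpM2r//; first by rewrite mulr_ge0// ltW.
  apply: le_trans (sum_square_le s t (fun n => powR_ge0 n.+1%:R (- 3))) _.
  have := @sum_powRN R 2 1 (s + t) ltr01; rewrite powR1E mul1r.
  rewrite (_ : 2 + 1 = 3 :> R); last ring.
  under eq_bigr do rewrite mulr1.
  by move=> ->; apply: zeta_sum_le_zeta; lra.
have e00 := e_ge0 0%N 0%N.
have c_le : c <= D 0%N 0%N by have := hD 0%N 0%N s0 t0; rewrite addn0 mul1r.
have core := force_core b1 ba (lt_le_trans c0 c_le) D00 D'1.
have : (a + 1 - k0) * (D' 0%N 0%N - D 0%N 0%N) <=
  (a + 1 - (b + 1) * D 0%N 0%N `^ (- (b + 2))) * (D' 0%N 0%N - D 0%N 0%N).
  rewrite ler_wpM2r ?subr_ge0// lerB// /k0 ler_wpM2l//; first lra.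
  by apply: le_trans cb; apply: ler_powRN => //; lra.
have : \sum_(i < s) \sum_(j < t) (force a b (D i j) - e i j) =
  \sum_(i < s) \sum_(j < t) force a b (D i j) - \sum_(i < s) \sum_(j < t) e i j.
  by rewrite -sumrB; apply: eq_bigr => i _; rewrite sumrB.
lra.
Qed.

(** At the gap where p' exceeds p most, by e, each distance across it grows by at most n e <=
    n^(b-1) e. Both cut sums vanish, so [comparison] with M = e bounds a positive multiple of e by
    0. Exchanging the chains gives equality of the gaps. *)
Lemma equilibrium_gap_le a b c N (p p' : nat -> R) :
  2 <= b -> b < a -> 0 < c -> c `^ (- (b + 2)) <= zeta b ->
  (a + 1) / (b + 1) * (2 * c) `^ (- (a - b)) <= 1 ->
  (b + 1) * zeta b * (1 + zeta 2) < a + 1 ->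
  equilibrium (force a b) N p -> equilibrium (force a b) N p' ->
  (forall l, (l.+1 < N)%N -> c <= gap p l <= 1) ->
  (forall l, (l.+1 < N)%N -> c <= gap p' l <= 1) ->
  forall l, (l.+1 < N)%N -> gap p' l <= gap p l.
Proof.
move=> b2 ba c0 cb ca a_big eq_p eq_p' hp hp' l0 l0N.
have b1 : 1 < b by lra.
have [l lN lmax] := @exists_argmin _ (fun m => gap p m - gap p' m) N.-1 ltac:(nat_lia).
have {}lN : (l.+1 < N)%N by nat_lia.
set e := gap p' l - gap p l.
have emax m : (m.+1 < N)%N -> gap p' m - gap p m <= e.
  by move=> mN; have := lmax m ltac:(nat_lia); rewrite /e; lra.
suff e0 : e <= 0 by have := emax l0 l0N; lra.
rewrite leNgt; apply/negP => e0.
have [/andP[cp p1] /andP[cp' p'1]] := (hp l lN, hp' l lN).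
have := @comparison a b c l.+1 (N - l.+1) (across p l) (across p' l) e.
rewrite !(cut_equation _ lN)// !across00 subrr => /(_ b1 ba c0 cb ca isT).
rewrite subn_gt0 => /(_ lN (ltW e0)).
have hDD' i j : (i < l.+1)%N -> (j < N - l.+1)%N ->
   across p' l i j - across p l i j <= (i + j).+1%:R `^ (b - 1) * e.
  move=> il jN; apply: (@le_trans _ _ ((i + j).+1%:R * e)); last first.
    rewrite ler_wpM2r ?(ltW e0)// -[leLHS]powRr1//.
    by apply: ler_powR; [rewrite ler1n|lra].
  rewrite !acrossE// -sumrB.
  have -> : (i + j).+1%:R * e = \sum_(l - i <= m < l.+1 + j) e.
    by rewrite big_const_nat iter_addr_0 mulr_natl; congr (_ *+ _); nat_lia.
  rewrite [leLHS]big_nat_cond [leRHS]big_nat_cond.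
  by apply: ler_sum => m /andP[/andP[_ mj] _]; apply: emax; nat_lia.
have hD i j : (i < l.+1)%N -> (j < N - l.+1)%N ->
   (i + j).+1%:R * c <= across p l i j.
  by apply: across_ge => m /hp /andP[].
have hD' i j : (i < l.+1)%N -> (j < N - l.+1)%N ->
   (i + j).+1%:R * c <= across p' l i j.
  by apply: across_ge => m /hp' /andP[].
have pp' : gap p l <= gap p' l by rewrite -subr_ge0 ltW.
move=> /(_ pp' p'1 hD hD' hDD'); rewrite -/e => h.
have : 0 < (a + 1 - (b + 1) * zeta b * (1 + zeta 2)) * e by rewrite mulr_gt0// subr_gt0.
lra.
Qed.

(** Across the smallest gap all distances are at least those of the uniform chain of spacing h, and
    beyond 2c the force decreases, so the uniform chain feels a nonnegative total force already with
    n < N. Completing it to an infinite chain adds the attractive tail, which gives the extra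
    term. *)
Lemma min_gap_lower a b c h N (p : nat -> R) l :
  1 < b -> 2 * b + 2 <= a -> 0 < c ->
  (a + 1) / (b + 1) * (2 * c) `^ (- (a - b)) <= 1 ->
  equilibrium (force a b) N p -> (l.+1 < N)%N -> gap p l = h ->
  (forall m, (m.+1 < N)%N -> h <= gap p m) -> c <= h -> h <= 1 ->
  h `^ (- (a + 1)) * zeta a + 2 `^ (- (b + 1)) * N%:R `^ (- (b - 1)) <=
  h `^ (- (b + 1)) * zeta b.
Proof.
move=> b1 a_big c0 ca eq_p lN gl hmin ch h1.
have ba : b < a by lra.
have h0 : 0 < h := lt_le_trans c0 ch.
have far n : (0 < n)%N -> (a + 1) / (b + 1) * (n.+1%:R * h) `^ (- (a - b)) <= 1.
  move=> n0; apply: le_trans ca; rewrite ler_wpM2l ?divr_ge0//; try lra.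
  apply: ler_powRN; [lra| |lra].
  by apply: ler_pM => //; [lra|rewrite ler_nat].
(* Since (a + 1) / (b + 1) >= 2, the far condition also makes the repulsion at most half of the
   attraction for all pairs but neighbours. *)
have half n : (0 < n)%N ->
    2^-1 * n.+1%:R `^ (- b) <= n.+1%:R * force a b (n.+1%:R * h).
  move=> n0; have nh0 : 0 < n.+1%:R * h by rewrite mulr_gt0// ltr0n.
  have small : (n.+1%:R * h) `^ (- (a - b)) <= 2^-1.
    have := far n n0; rewrite mulrAC ler_pdivrMr; last lra.
    set X := _ `^ _; have : 0 <= X by exact: powR_ge0.
    move=> X0 h2; have : 0 <= (a + 1 - 2 * (b + 1)) * X by rewrite mulr_ge0//; lra.
    by nra.
  rewrite /force mulrBr natrM_powRN//.
  rewrite (_ : - (a + 1) = - (b + 1) + - (a - b)); last ring.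
  rewrite powRD_gt0// mulrA natrM_powRN//.
  have : 1 <= h `^ (- (b + 1)) by apply: powRN_ge1 => //; lra.
  have : 0 <= (n.+1%:R : R) `^ (- b) by exact: powR_ge0.
  move: small; set X := _ `^ _; set Y := _ `^ _; set Z := _ `^ _ => X2 Y0 Z1.
  have : 0 <= (Z - 1) * Y by rewrite mulr_ge0// subr_ge0.
  have : 0 <= (2^-1 - X) * (Z * Y) by rewrite !mulr_ge0// ?subr_ge0//; lra.
  lra.
have sumE (m : nat) : \sum_(n < m) n.+1%:R * force a b (n.+1%:R * h) =
   h `^ (- (b + 1)) * zeta_sum b m - h `^ (- (a + 1)) * zeta_sum a m.
  by rewrite -!sum_powRN// -sumrB; apply: eq_bigr => n _; rewrite -mulrBr.
have sum_ge0 : 0 <= \sum_(n < N) n.+1%:R * force a b (n.+1%:R * h).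
  have := @sum_square_le_corner _ (fun n => force a b (n.+1%:R * h)) l.+1 (N - l.+1) isT.
  rewrite subn_gt0 subnKC ?(ltnW lN)// => /(_ lN) sq.
  apply: le_trans (sq _); last first.
    move=> n n0; rewrite -(@pmulr_rge0 _ n.+1%:R) ?ltr0n//.
    by apply: le_trans (half n n0); rewrite mulr_ge0// powR_ge0.
  have := @ler_sum2_corner _ (fun i j => force a b (across p l i j))
     (fun i j => force a b ((i + j).+1%:R * h)) l.+1 (N - l.+1) isT.
  rewrite subn_gt0 (cut_equation eq_p lN) across00 gl mul1r add0r -{1}[force a b h]add0r.
  rewrite lerD2r => /(_ lN); apply => i j il jN ij0.
  apply: (force_anti b1 ba); last exact: far.
    by rewrite mulr_gt0// ltr0n.
  exact: (across_ge hmin).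
have N0 : (0 : R) < N%:R by rewrite ltr0n; nat_lia.
suff za : h `^ (- (a + 1)) * zeta a <= h `^ (- (b + 1)) * zeta b -
     2 `^ (- (b + 1)) * N%:R `^ (- (b - 1)) by lra.
(* The bound on zeta a is passed to the limit from partial sums of length m >= 2N, so that the block
   from N to 2N is always included. *)
rewrite mulrC -ler_pdivlMr ?powR_gt0// [leLHS]zetaE.
apply: limr_le; first by apply: is_cvg_zeta_sum; lra.
exists (N + N)%N => // m /= Nm; rewrite ler_pdivlMr ?powR_gt0// mulrC.
suff : 2 `^ (- (b + 1)) * N%:R `^ (- (b - 1)) <=
    \sum_(n < m) n.+1%:R * force a b (n.+1%:R * h).
  rewrite sumE; have : h `^ (- (b + 1)) * zeta_sum b m <= h `^ (- (b + 1)) * zeta b.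
    by rewrite ler_wpM2l ?powR_ge0// zeta_sum_le_zeta.
  lra.
pose F n := n.+1%:R * force a b (n.+1%:R * h).
rewrite -(big_mkord xpredT F) (big_cat_nat (n := N))//=; last by nat_lia.
rewrite big_mkord; apply: le_trans (_ : 0 + _ <= _); last by rewrite lerD.
rewrite add0r (big_cat_nat (n := N + N))//=; last by nat_lia.
rewrite -[leLHS]addr0 lerD//; last first.
  rewrite big_nat_cond sumr_ge0// => n /andP[/andP[nN _] _].
  by apply: le_trans (half n ltac:(nat_lia)); rewrite mulr_ge0// powR_ge0.
(* The block has N terms, each at least half of (2N)^(-b). *)
have -> : 2 `^ (- (b + 1)) * N%:R `^ (- (b - 1)) =
    \sum_(N <= n < N + N) (2^-1 * (N + N)%:R `^ (- b) : R).
  rewrite big_const_nat iter_addr_0 addnK addnn -mul2n natrM powRM//.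
  rewrite -[RHS]mulr_natl -(powR_inv1 (ltW (ltr0Sn _ 1))).
  rewrite mulrA [X in X * _ = _](_ : _ = 2 `^ (- b) * 2 `^ (- 1)); last first.
    by rewrite -powRD_gt0//; congr powR; ring.
  rewrite (_ : - (b - 1) = - b + 1); last ring.
  by rewrite powRD_gt0// powRr1 ?(ltW N0)//; ring.
rewrite [leLHS]big_nat_cond [leRHS]big_nat_cond.
apply: ler_sum => n /andP[/andP[Nn nN] _]; apply: le_trans (half n ltac:(nat_lia)).
rewrite ler_wpM2l//; apply: ler_powRN; [by rewrite ltr0n|by rewrite ler_nat; nat_lia|lra].
Qed.

End Comparison.

(** * Distance of the gaps from the infinite-chain spacing *)

Section GapEstimates.
Context {R : realType}.
Implicit Types (a b c h q : R).

(** Multiplying [min_gap_lower] by h^(a+1) makes h^(a-b) zeta b exceed zeta a = hb^(a-b) zeta b by a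
    definite amount. The tangent to the power a - b at h, whose slope is at most a - b because h <=
    1, turns this into an excess of h over hb. *)
Lemma gap_ge_hbar a b c hb N (p : nat -> R) :
  1 < b -> 2 * b + 2 <= a -> 0 < c ->
  (a + 1) / (b + 1) * (2 * c) `^ (- (a - b)) <= 1 ->
  equilibrium (force a b) N p ->
  (forall l, (l.+1 < N)%N -> c <= gap p l <= 1) ->
  0 < hb -> hb `^ (a - b) * zeta b = zeta a ->
  forall l, (l.+1 < N)%N ->
    hb + 2 `^ (- (b + 1)) * c `^ (a + 1) / (zeta b * (a - b)) * N%:R `^ (- (b - 1))
    <= gap p l.
Proof.
move=> b1 a_big c0 ca eq_p hp hb0 hbE l0 l0N.
have [l lN' lmin] := @exists_argmin _ (gap p) N.-1 ltac:(nat_lia).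
have lN : (l.+1 < N)%N by nat_lia.
have hmin m : (m.+1 < N)%N -> gap p l <= gap p m by move=> mN; apply: lmin; nat_lia.
apply: le_trans (hmin _ l0N); set h := gap p l in hmin *.
have [ch h1] := andP (hp l lN); rewrite -/h in ch h1.
have h0 : 0 < h by lra.
have z0 : 0 < zeta b := zeta_gt0 b1.
have := min_gap_lower b1 a_big c0 ca eq_p lN erefl hmin ch h1.
rewrite -(ler_pM2l (powR_gt0 (a + 1) h0)) mulrDr !mulrA powRMN// -powRD_gt0//.
rewrite (_ : a + 1 + - (b + 1) = a - b); last ring.
set T := N%:R `^ _; have T0 : 0 <= T by exact: powR_ge0.
have : c `^ (a + 1) <= h `^ (a + 1).
  by apply: ge0_ler_powR => //; rewrite ?nnegrE; lra.
set S := 2 `^ _; have S0 : 0 <= S by exact: powR_ge0.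
set ca1 := c `^ _; set ha1 := h `^ _ => cha.
have cST : ca1 * S * T <= ha1 * S * T by rewrite ler_wpM2r// ler_wpM2r.
rewrite mul1r -hbE => hlow.
have d1 : 1 <= a - b by lra.
have tang : hb `^ (a - b) >= h `^ (a - b) + (a - b) * h `^ (a - b - 1) * (hb - h).
  by apply: powR_tangent => //; rewrite d1 orbT.
have hd1 : h `^ (a - b - 1) <= 1 by apply: powR_le1 => //; lra.
have hd0 : 0 < h `^ (a - b - 1) by apply: powR_gt0.
set d := a - b in d1 tang hd1 hd0 hlow *; set X := h `^ (d - 1) in tang hd1 hd0.
have key : ca1 * S * T <= d * X * (h - hb) * zeta b.
  apply: le_trans (_ : (h `^ d - hb `^ d) * zeta b <= _); first lra.
  by rewrite ler_wpM2r//; [exact: ltW|lra].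
(* The sign of h - hb is needed before h^(a-b-1) can be replaced by 1. *)
have hhb : 0 <= h - hb.
  have : 0 <= d * X * (h - hb) * zeta b.
    by apply: le_trans key; rewrite !mulr_ge0// powR_ge0.
  by rewrite pmulr_lge0// pmulr_rge0// mulr_gt0//; lra.
have key2 : d * X * (h - hb) * zeta b <= d * (h - hb) * zeta b.
  rewrite ler_wpM2r ?(ltW z0)// ler_wpM2r// ler_piMr//; lra.
suff : S * ca1 / (zeta b * d) * T <= h - hb by lra.
rewrite mulrAC ler_pdivrMr; last by rewrite mulr_gt0//; lra.
lra.
Qed.

(** Divide y^q <= (2 max(x, n))^q <= 2^q (x^q + n^q) by x^q y^q. *)
Lemma powRN_shift q x y n : 0 <= q -> 0 < x -> 0 < n -> 0 < y -> y <= x + n ->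
  x `^ (- q) <= 2 `^ q * y `^ (- q) * (1 + n `^ q * x `^ (- q)).
Proof.
move=> q0 x0 n0 y0 yxn.
have key : y `^ q <= 2 `^ q * (x `^ q + n `^ q).
  have [xn|nx] := leP x n.
    apply: (@le_trans _ _ ((2 * n) `^ q)).
      by apply: ge0_ler_powR; rewrite ?nnegrE; lra.
    by rewrite powRM ?(ltW n0)// ler_wpM2l ?powR_ge0// lerDr powR_ge0.
  apply: (@le_trans _ _ ((2 * x) `^ q)).
    by apply: ge0_ler_powR; rewrite ?nnegrE; lra.
  by rewrite powRM ?(ltW x0)// ler_wpM2l ?powR_ge0// lerDl powR_ge0.
have xq := powRMN q x0; have yq := powRMN q y0.
have yq0 := powR_gt0 (- q) y0; have xq0 := powR_gt0 (- q) x0.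
have -> : 2 `^ q * y `^ (- q) * (1 + n `^ q * x `^ (- q)) =
   2 `^ q * (x `^ q + n `^ q) * (y `^ (- q) * x `^ (- q)).
  rewrite (_ : 1 + _ = (x `^ q + n `^ q) * x `^ (- q)); first by ring.
  by rewrite mulrDl xq.
rewrite [leLHS](_ : _ = y `^ q * (y `^ (- q) * x `^ (- q))); last first.
  by rewrite mulrA yq mul1r.
by rewrite ler_wpM2r// mulr_ge0// ltW.
Qed.

Lemma sum_powRN_shift q (x : nat -> R) y Z n A B : 1 <= q -> (A < B)%N ->
  (B - A)%N = n ->
  (forall m, (A <= m < B)%N -> 0 < x m) -> 0 < y ->
  (forall m, (A <= m < B)%N -> y <= x m + n%:R) ->
  \sum_(A <= m < B) x m `^ (- q) <= Z ->
  \sum_(A <= m < B) x m `^ (- q) <=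
    2 `^ q * (1 + Z) * n%:R `^ q * y `^ (- q).
Proof.
move=> q1 AB BAn x0 y0 yx xZ.
have n1 : (1 : R) <= n%:R by rewrite ler1n -BAn subn_gt0.
apply: (@le_trans _ _ (\sum_(A <= m < B) 2 `^ q * y `^ (- q) *
    (1 + n%:R `^ q * x m `^ (- q)))).
  rewrite [leLHS]big_nat_cond [leRHS]big_nat_cond.
  apply: ler_sum => m /andP[mAB _]; apply: powRN_shift; [lra|exact: x0|lra|by []|exact: yx].
rewrite -mulr_sumr big_split/= -mulr_sumr.
have -> : \sum_(A <= m < B) (1 : R) = n%:R.
  by rewrite big_const_nat iter_addr_0 BAn.
have nq : n%:R <= n%:R `^ q by rewrite -[leLHS]powRr1 ?ler_powR//; lra.
have nqZ := ler_wpM2l (powR_ge0 n%:R q) xZ.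
have -> : 2 `^ q * (1 + Z) * n%:R `^ q * y `^ (- q) =
  2 `^ q * y `^ (- q) * (n%:R `^ q + n%:R `^ q * Z) by ring.
by rewrite ler_wpM2l ?mulr_ge0 ?powR_ge0// lerD.
Qed.

(* l.+1 and N - l.+1 are the numbers of particles on the two sides of the l-th
   gap. *)
Definition weight q N l : R := l.+1%:R `^ (- q) + (N - l.+1)%:R `^ (- q).

(** An excess proportional to the weight, summed over a window of n gaps, grows no faster than n^q
    times its value at l. With q = b - 1 this is the growth that [comparison] admits. The two halves
    of the weight are treated alike, each with total sum at most zeta q. *)
Lemma weight_window q N l i j : 1 < q -> (l.+1 < N)%N ->
  (i < l.+1)%N -> (j < N - l.+1)%N ->
  \sum_(l - i <= m < l.+1 + j) weight q N m <=
  2 `^ q * (1 + zeta q) * (i + j).+1%:R `^ q * weight q N l.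
Proof.
move=> q1 lN il jN.
rewrite big_split/= /weight mulrDr lerD//.
  apply: sum_powRN_shift; [lra|nat_lia|nat_lia| | | |].
  - by move=> m _; rewrite ltr0n.
  - by rewrite ltr0n.
  - by move=> m mb; rewrite -natrD ler_nat; nat_lia.
  - apply: le_trans (zeta_sum_le_zeta (l.+1 + j) q1).
    by rewrite (@zeta_sum_cat _ _ (l - i)) ?lerDr ?sumr_ge0 ?powR_ge0//; nat_lia.
apply: sum_powRN_shift; [lra|nat_lia|nat_lia| | | |].
- by move=> m mb; rewrite ltr0n; nat_lia.
- by rewrite ltr0n; nat_lia.
- by move=> m mb; rewrite -natrD ler_nat; nat_lia.
- apply: le_trans (zeta_sum_le_zeta N.-1 q1).
  rewrite [leRHS]big_nat_rev/= add0n [leRHS](big_cat_nat (n := l - i))//=; last by nat_lia.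
  rewrite [X in _ <= _ + X](big_cat_nat (n := l.+1 + j))//=; [|nat_lia|nat_lia].
  rewrite addrCA [leRHS](_ : _ = \sum_(l - i <= m < l.+1 + j) (N - m.+1)%:R `^ (- q) +
    (\sum_(0 <= m < l - i) (N.-1 - m.+1).+1%:R `^ (- q) +
     \sum_(l.+1 + j <= m < N.-1) (N.-1 - m.+1).+1%:R `^ (- q))).
    by rewrite lerDl addr_ge0// sumr_ge0// => m _; exact: powR_ge0.
  congr (_ + _); apply: eq_big_nat => m mb; congr (_%:R `^ _); nat_lia.
Qed.

(** Apply [comparison] to the uniform chain of spacing hb and to p, at the gap where the excess over
    hb relative to the weight is largest, say E. The chain p has cut sum zero, so E times the weight
    is at most the defect of the finite uniform chain from equilibrium. *)
Lemma gap_le_hbar a b c hb N (p : nat -> R) :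
  3 <= b -> 2 * b + 2 <= a -> 0 < c -> c `^ (- (b + 2)) <= zeta b ->
  (a + 1) / (b + 1) * (2 * c) `^ (- (a - b)) <= 1 ->
  1 + (b + 1) * zeta b * (1 + zeta 2 * (2 `^ (b - 1) * (1 + zeta (b - 1)))) <= a + 1 ->
  equilibrium (force a b) N p ->
  c <= hb -> hb `^ (a - b) * zeta b = zeta a ->
  (forall l, (l.+1 < N)%N -> hb <= gap p l <= 1) ->
  forall l, (l.+1 < N)%N ->
    gap p l <= hb + hb `^ (- (b + 1)) / (b - 1) * weight (b - 1) N l.
Proof.
move=> b3 a_big c0; have b1 : 1 < b by lra.
have ba : b < a by lra.
move=> cb ca a_big' eq_p chb hbE hp l0 l0N; have hb0 := lt_le_trans c0 chb.
have w_gt0 l : 0 < weight (b - 1) N l.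
  by rewrite ltr_wpDr ?powR_ge0// powR_gt0// ltr0n.
have [l lN' lmax] := @exists_argmin _
  (fun m => - ((gap p m - hb) / weight (b - 1) N m)) N.-1 ltac:(nat_lia).
have lN : (l.+1 < N)%N by nat_lia.
set E := (gap p l - hb) / weight (b - 1) N l.
have Emax m : (m.+1 < N)%N -> gap p m - hb <= E * weight (b - 1) N m.
  by move=> mN; rewrite -ler_pdivrMr//; have := lmax m ltac:(nat_lia); rewrite lerN2.
have [hbl p1] := andP (hp l lN).
have E0 : 0 <= E by rewrite divr_ge0 ?subr_ge0// ltW.
have lE : gap p l - hb = E * weight (b - 1) N l by rewrite divfK// gt_eqF.
set C1 := hb `^ _ / _.
suff EC : E <= C1.
  by have := Emax l0 l0N; have := ler_wpM2r (ltW (w_gt0 l0)) EC; lra.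
set K := 2 `^ (b - 1) * (1 + zeta (b - 1)) in a_big'.
have K0 : 0 <= K.
  have zq0 : 0 < zeta (b - 1) by apply: zeta_gt0; lra.
  by apply: mulr_ge0; [exact: powR_ge0|exact: addr_ge0 ler01 (ltW zq0)].
set w := weight (b - 1) N l in lE.
have w0 : 0 < w := w_gt0 l.
have M0 : 0 <= E * K * w by exact: mulr_ge0 (mulr_ge0 E0 K0) (ltW w0).
have t0 : (0 < N - l.+1)%N by rewrite subn_gt0.
have hD i j : (i < l.+1)%N -> (j < N - l.+1)%N ->
    (i + j).+1%:R * c <= (i + j).+1%:R * hb :> R.
  by move=> _ _; rewrite ler_wpM2l.
have hD' i j : (i < l.+1)%N -> (j < N - l.+1)%N ->
   (i + j).+1%:R * c <= across p l i j.
  by apply: across_ge => m /hp /andP[+ _]; exact: le_trans.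
have hDD' i j : (i < l.+1)%N -> (j < N - l.+1)%N ->
   across p l i j - (i + j).+1%:R * hb <= (i + j).+1%:R `^ (b - 1) * (E * K * w).
  move=> il jN; rewrite acrossE//.
  have -> : (i + j).+1%:R * hb = \sum_(l - i <= m < l.+1 + j) hb.
    by rewrite big_const_nat iter_addr_0 mulr_natl; congr (_ *+ _); nat_lia.
  rewrite -sumrB.
  apply: (@le_trans _ _ (\sum_(l - i <= m < l.+1 + j) E * weight (b - 1) N m)).
    rewrite [leLHS]big_nat_cond [leRHS]big_nat_cond.
    by apply: ler_sum => m /andP[/andP[_ mj] _]; apply: Emax; nat_lia.
  rewrite -mulr_sumr.
  have -> : (i + j).+1%:R `^ (b - 1) * (E * K * w) =
    E * (K * (i + j).+1%:R `^ (b - 1) * w) by ring.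
  rewrite ler_wpM2l//; apply: weight_window => //; lra.
have := @comparison _ a b c l.+1 (N - l.+1) (fun i j => (i + j).+1%:R * hb)
  (across p l) (E * K * w) b1 ba c0 cb ca isT t0 M0.
rewrite across00 mul1r (cut_equation eq_p lN) => /(_ hbl p1 hD hD' hDD').
rewrite lE => comp.
have low : - (C1 * w) <=
   \sum_(i < l.+1) \sum_(j < N - l.+1) force a b ((i + j).+1%:R * hb).
  have -> : \sum_(i < l.+1) \sum_(j < N - l.+1) force a b ((i + j).+1%:R * hb) =
    \sum_(i < l.+1) \sum_(j < N - l.+1) ((i + j).+1%:R * hb) `^ (- (b + 1)) -
    \sum_(i < l.+1) \sum_(j < N - l.+1) ((i + j).+1%:R * hb) `^ (- (a + 1)).
    by rewrite -sumrB; apply: eq_bigr => i _; rewrite -sumrB.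
  have up : \sum_(i < l.+1) \sum_(j < N - l.+1) ((i + j).+1%:R * hb) `^ (- (a + 1))
     <= hb `^ (- (a + 1)) * zeta a.
    apply: le_trans (sum_square_le _ _ (fun n => powR_ge0 (n.+1%:R * hb) (- (a + 1)))) _.
    by rewrite sum_powRN// ler_wpM2l ?powR_ge0// zeta_sum_le_zeta//; lra.
  (* Up to the length m of the shorter side, a distance n hb occurs exactly n times. The attraction
     missing from zeta b is then at most a tail of order m^(1-b), which the weight dominates. *)
  set m := minn l.+1 (N - l.+1).
  have m0 : (0 < m)%N by rewrite /m; nat_lia.
  have dn : hb `^ (- (b + 1)) * zeta_sum b m <=
    \sum_(i < l.+1) \sum_(j < N - l.+1) ((i + j).+1%:R * hb) `^ (- (b + 1)).
    rewrite -sum_powRN//.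
    by apply: (sum_square_ge (fun n => powR_ge0 (n.+1%:R * hb) (- (b + 1))));
      rewrite /m; nat_lia.
  have mw : m%:R `^ (1 - b) <= w.
    rewrite /w /weight opprB /m; case: (leqP l.+1 (N - l.+1)) => _.
      by rewrite lerDl powR_ge0.
    by rewrite lerDr powR_ge0.
  have tail := zeta_le_tail b1 m0.
  have bal : hb `^ (- (a + 1)) * zeta a = hb `^ (- (b + 1)) * zeta b.
    rewrite -hbE mulrA -powRD_gt0//; congr (_ `^ _ * _); ring.
  have tail' : hb `^ (- (b + 1)) * zeta b <= hb `^ (- (b + 1)) * zeta_sum b m + C1 * w.
    have := ler_wpM2l (powR_ge0 hb (- (b + 1))) tail; rewrite mulrDr => /le_trans; apply.
    rewrite lerD2l mulrA mulrAC; apply: ler_wpM2l => //.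
    by rewrite divr_ge0 ?powR_ge0//; lra.
  lra.
have coef : E * w <= (a + 1 - (b + 1) * zeta b) * (E * w) -
   (b + 1) * zeta b * zeta 2 * (E * K * w).
  rewrite (_ : _ - _ = (a + 1 - (b + 1) * zeta b * (1 + zeta 2 * K)) * (E * w)); last ring.
  have Ew0 : 0 <= E * w := mulr_ge0 E0 (ltW w0).
  apply: ler_peMl => //; move: a_big'.
  set X := _ * (1 + _); lra.
by rewrite -(ler_pM2r w0); lra.
Qed.

End GapEstimates.

(** * First variation of the pair energy at an aligned pair *)

Section Derivatives.
Context {R : realType}.
Implicit Types (A B a b : R) (u v r m : R -> 'rV[R]_3) (f g : R -> R).

Definition pair_force A B a b (x : R) :=
  b * B * x `^ (- (b + 1)) - a * A * x `^ (- (a + 1)).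

Lemma is_derive_mul_fun f g (x df dg : R) : is_derive x 1 f df -> is_derive x 1 g dg ->
  is_derive x 1 (fun t => f t * g t) (f x * dg + g x * df).
Proof. by move=> hf hg; exact: is_deriveM. Qed.

Lemma is_derive_add_fun f g (x df dg : R) : is_derive x 1 f df -> is_derive x 1 g dg ->
  is_derive x 1 (fun t => f t + g t) (df + dg).
Proof. by move=> hf hg; exact: is_deriveD. Qed.

Lemma is_derive_sum_fun n (P : pred 'I_n) (h : 'I_n -> R -> R) (x : R) (dh : 'I_n -> R) :
  (forall i, P i -> is_derive x 1 (h i) (dh i)) ->
  is_derive x 1 (fun t => \sum_(i < n | P i) h i t) (\sum_(i < n | P i) dh i).
Proof.
move=> hh.
have -> : (fun t => \sum_(i < n | P i) h i t) =
    \sum_(i < n) (fun t => if P i then h i t else 0).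
  by apply/funext => t; rewrite fct_sumE big_mkcond.
rewrite [X in is_derive _ _ _ X]big_mkcond; apply: is_derive_sum => i.
by case: ifP => [/hh//|_]; exact: is_derive_cst.
Qed.

(** Both vectors lie on the axis at time 0, so their transverse components enter the product only at
    second order. *)
Lemma is_derive_dot u v (x y : R) :
  derivable u 0 1 -> derivable v 0 1 ->
  u 0 = x *: delta_mx 0 0 -> v 0 = y *: delta_mx 0 0 ->
  is_derive (0 : R) 1 (fun t => dot (u t) (v t))
    (x * 'D_1 (fun t => v t 0 0) 0 + y * 'D_1 (fun t => u t 0 0) 0).
Proof.
move=> /derivable_mxP du /derivable_mxP dv u0 v0.
have := @is_derive_sum_fun 3 xpredT (fun i t => u t 0 i * v t 0 i) 0 _
  (fun i _ => is_derive_mul_fun (derivableP (du 0 i)) (derivableP (dv 0 i))).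
move=> h; apply: (is_derive_eq h).
rewrite big_ord_recl big1 ?addr0; last first.
  move=> i _; rewrite u0 v0 !mxE/= !mulr0 !mul0r addr0//.
by rewrite u0 v0 !mxE !eqxx/= !mulr1.
Qed.

Lemma dot_ge0 (w : 'rV[R]_3) : 0 <= dot w w.
Proof. by apply: sumr_ge0 => i _; rewrite -expr2 sqr_ge0. Qed.

Lemma enorm_powR (w : 'rV[R]_3) (s : R) : enorm w `^ s = dot w w `^ (s / 2).
Proof. by rewrite /enorm -powR12_sqrt ?dot_ge0// -powRrM mulrC. Qed.

Lemma dot_axis (x y : R) :
  dot (x *: delta_mx 0 0) (y *: delta_mx 0 0 : 'rV[R]_3) = x * y.
Proof.
rewrite /dot big_ord_recl big1 ?addr0; last first.
  by move=> i _; rewrite !mxE/= !mulr0.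
by rewrite !mxE eqxx/= !mulr1.
Qed.

Lemma enorm_axis (x : R) : enorm (x *: delta_mx 0 0) = `|x|.
Proof. by rewrite /enorm dot_axis -expr2 sqrtr_sqr. Qed.

Lemma is_derive_enorm_powR r (x s : R) :
  derivable r 0 1 -> 0 < x -> r 0 = x *: delta_mx 0 0 ->
  is_derive (0 : R) 1 (fun t => enorm (r t) `^ s)
    (s * x `^ (s - 1) * 'D_1 (fun t => r t 0 0) 0).
Proof.
move=> dr x0 r0.
have -> : (fun t => enorm (r t) `^ s) =
    (fun y : R => y `^ (s / 2)) \o (fun t => dot (r t) (r t)).
  by apply/funext => t /=; rewrite enorm_powR.
have dq := is_derive_dot dr dr r0 r0.
have q0 : 0 < dot (r 0) (r 0) by rewrite r0 dot_axis mulr_gt0.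
have dp := @is_derive1_powR R (s / 2) _ q0.
apply: (is_derive_eq (is_derive1_comp dp dq)).
rewrite r0 dot_axis; have -> : x * x = x `^ 2 by rewrite powR_mulrn ?(ltW x0)// expr2.
rewrite -powRrM (_ : 2 * (s / 2 - 1) = s - 1 - 1); last by field.
rewrite (_ : x `^ (s - 1) = x * x `^ (s - 1 - 1)); last first.
  by rewrite -[X in X * _](powRr1 (ltW x0)) -powRD_gt0//; congr powR; ring.
by field.
Qed.

(** Differentiating the constant [dot (m t) (m t)]: a tangent vector of the sphere at the axis is
    orthogonal to the axis. *)
Lemma unit_curve_derive m : derivable m 0 1 -> m 0 = delta_mx 0 0 ->
  (\forall t \near (0 : R), enorm (m t) = 1) ->
  'D_1 (fun t => m t 0 0) 0 = 0.
Proof.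
move=> dm m0 m1.
have m0' : m 0 = 1 *: delta_mx 0 0 by rewrite scale1r.
have h := is_derive_dot dm dm m0' m0'.
have : is_derive (0 : R) 1 (fun t => dot (m t) (m t)) 0.
  apply: near_eq_is_derive (is_derive_cst (1 : R) _ _).
  near=> t; rewrite /cst.
  have mt : enorm (m t) = 1 by near: t.
  by rewrite -[LHS](expr1n _ 2) -mt sqr_sqrtr// dot_ge0.
move=> [_ h2]; have [_] := h; rewrite h2; lra.
Unshelve. all: by end_near. Qed.

(** The moments have no axial velocity and so contribute nothing; only the axial velocity of r
    survives. The two occurrences of [B0] cancel, leaving -B x^(-b) + A x^(-a) to be
    differentiated. *)
Lemma is_derive_pair_energy A B (B0 : R) a b r m m' (x : R) :
  derivable r 0 1 -> derivable m 0 1 -> derivable m' 0 1 ->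
  0 < x -> r 0 = x *: delta_mx 0 0 -> m 0 = delta_mx 0 0 -> m' 0 = delta_mx 0 0 ->
  (\forall t \near (0 : R), enorm (m t) = 1) ->
  (\forall t \near (0 : R), enorm (m' t) = 1) ->
  is_derive (0 : R) 1 (fun t => pair_energy A B B0 a b (r t) (m t) (m' t))
    (pair_force A B a b x * 'D_1 (fun t => r t 0 0) 0).
Proof.
move=> dr dm dm' x0 r0 m0 m'0 m1 m'1.
have Dm := unit_curve_derive dm m0 m1.
have Dm' := unit_curve_derive dm' m'0 m'1.
have m0' : m 0 = 1 *: delta_mx 0 0 by rewrite scale1r.
have m'0' : m' 0 = 1 *: delta_mx 0 0 by rewrite scale1r.
have hmm := is_derive_dot dm dm' m0' m'0'.
have hmr := is_derive_dot dm dr m0' r0.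
have hm'r := is_derive_dot dm' dr m'0' r0.
have hb := is_derive_enorm_powR (- b) dr x0 r0.
have hb2 := is_derive_enorm_powR (- (b + 2)) dr x0 r0.
have ha := is_derive_enorm_powR (- a) dr x0 r0.
rewrite Dm Dm' in hmm hmr hm'r.
have -> : (fun t => pair_energy A B B0 a b (r t) (m t) (m' t)) = (fun t =>
    B0 * (dot (m t) (m' t) * enorm (r t) `^ (- b)) +
    (- (B + B0)) * (dot (m t) (r t) * dot (m' t) (r t) * enorm (r t) `^ (- (b + 2))) +
    A * enorm (r t) `^ (- a)).
  by apply/funext => t; rewrite /pair_energy !powRN; ring.
have cstd (k : R) : is_derive (0 : R) 1 (fun=> k) 0 by exact: is_derive_cst.
have h1 := is_derive_mul_fun (cstd B0) (is_derive_mul_fun hmm hb).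
have h2 := is_derive_mul_fun (cstd (- (B + B0)))
  (is_derive_mul_fun (is_derive_mul_fun hmr hm'r) hb2).
have h3 := is_derive_mul_fun (cstd A) ha.
apply: (is_derive_eq (is_derive_add_fun (is_derive_add_fun h1 h2) h3)).
rewrite r0 m0' m'0' !dot_axis !enorm_axis gtr0_norm//.
set d := 'D_1 (fun t => r t 0 0) 0.
rewrite /pair_force (_ : - (a + 1) = - a - 1); last ring.
rewrite (_ : - b - 1 = - (b + 2) + 1); last ring.
rewrite (_ : - (b + 1) = - (b + 2) + 1); last ring.
rewrite (_ : - b = - (b + 2) + 1 + 1); last ring.
rewrite (_ : - (b + 2) - 1 = - (b + 2) + (- 1)); last ring.
rewrite !powRD_gt0// powRr1 ?(ltW x0)// powR_inv1 ?(ltW x0)//.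
by field; rewrite gt_eqF.
Qed.

End Derivatives.

(** * Critical spears as one-dimensional equilibria *)

Section CriticalSpears.
Context {R : realType}.
Implicit Types (A B a b x d : R).

Lemma increasing_coords_near N (P v : 'rV[R]_N) : increasing_coords P ->
  \forall t \near (0 : R), increasing_coords (P + t *: v).
Proof.
move=> Pinc.
pose lt_at (ij : 'I_N * 'I_N) (t : R) :=
  (ij.1 < ij.2)%N -> (P + t *: v) 0 ij.1 < (P + t *: v) 0 ij.2.
have near_lt : forall ij, \forall t \near (0 : R), lt_at ij t.
  move=> [i j]; rewrite /lt_at/=; case: (ltnP i j) => ij; last by near=> t.
  pose f (t : R) : R := (P 0 j - P 0 i) + t * (v 0 j - v 0 i).
  have cf : (f @ (0 : R) --> f 0)%classic.
    apply: cvgD; first exact: cvg_cst.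
    by apply: cvgM; [exact: cvg_id|exact: cvg_cst].
  have f0 : 0 < f 0 by rewrite /f mul0r addr0 subr_gt0 Pinc.
  near=> t => _; rewrite !mxE -subr_gt0.
  have -> : P 0 j + t * v 0 j - (P 0 i + t * v 0 i) = f t by rewrite /f; ring.
  by near: t; exact: (cvgr_gt _ cf).
by apply: filterS (filter_forall _ near_lt) => t h i j ij; exact: (h (i, j)).
Unshelve. all: by end_near. Qed.

Lemma spear_pos00 N (P : 'rV[R]_N) k : spear_pos P k 0 0 = P 0 k.
Proof. by rewrite !mxE eqxx mulr1. Qed.

Lemma spear_pos_inj N (P : 'rV[R]_N) : increasing_coords P -> injective (spear_pos P).
Proof.
move=> Pinc i j /(congr1 (fun w : 'rV[R]_3 => w 0 0)).
rewrite !spear_pos00 => Pij; apply: val_inj => /=.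
by case: (ltngtP i j) => // /Pinc; rewrite Pij ltxx.
Qed.

Lemma enorm_spear_mom N (k : 'I_N) : enorm (@spear_mom R N k) = 1.
Proof. by rewrite /spear_mom -[delta_mx _ _]scale1r enorm_axis normr1. Qed.

Lemma spear_configuration N (P : 'rV[R]_N) : increasing_coords P ->
  configuration (spear_pos P) (@spear_mom R N).
Proof. by move=> /spear_pos_inj Pinj; split=> // k; exact: enorm_spear_mom. Qed.

Lemma spear_posB N (P : 'rV[R]_N) k l :
  spear_pos P k - spear_pos P l = (P 0 k - P 0 l) *: delta_mx 0 0.
Proof. by rewrite /spear_pos -scalerBl. Qed.

Lemma is_derive_energy A B (B0 : R) a b N (P : 'rV[R]_N) (Xt Mt : R -> 'I_N -> 'rV[R]_3) :
  increasing_coords P -> Xt 0 = spear_pos P -> Mt 0 = @spear_mom R N ->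
  (\forall t \near (0 : R), configuration (Xt t) (Mt t)) ->
  (forall k, derivable (fun t => Xt t k) 0 1 /\ derivable (fun t => Mt t k) 0 1) ->
  is_derive (0 : R) 1 (fun t => energy A B B0 a b (Xt t) (Mt t))
    (\sum_(k < N) \sum_(l < N | (l < k)%N) pair_force A B a b (P 0 k - P 0 l) *
      ('D_1 (fun t => Xt t k 0 0) 0 - 'D_1 (fun t => Xt t l 0 0) 0)).
Proof.
move=> Pinc X0 M0 conf dXM.
apply: is_derive_sum_fun => k _; apply: is_derive_sum_fun => l lk.
have [[dXk dMk] [dXl dMl]] := (dXM k, dXM l).
have dr : derivable (fun t => Xt t k - Xt t l) 0 1 by exact: derivableB.
have -> : 'D_1 (fun t => Xt t k 0 0) 0 - 'D_1 (fun t => Xt t l 0 0) 0 =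
    'D_1 (fun t => (Xt t k - Xt t l) 0 0) 0.
  have hk := derivableP ((derivable_mxP _ _ _).1 dXk 0 0).
  have hl := derivableP ((derivable_mxP _ _ _).1 dXl 0 0).
  rewrite (_ : (fun t => (Xt t k - Xt t l) 0 0) =
    (fun t => Xt t k 0 0) - (fun t => Xt t l 0 0)).
    by have [_ ->] := is_deriveB hk hl.
  by apply/funext => t; rewrite [LHS]mxE [X in _ + X]mxE.
apply: is_derive_pair_energy => //.
- by rewrite subr_gt0 Pinc.
- by rewrite X0 spear_posB.
- by rewrite M0.
- by rewrite M0.
- by apply: filterS conf => t [_ /(_ k)].
- by apply: filterS conf => t [_ /(_ l)].
Qed.

Lemma derivable_line N (P v : 'rV[R]_N) k :
  is_derive (0 : R) 1 (fun t : R => (P + t *: v) 0 k) (v 0 k).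
Proof.
have -> : (fun t : R => (P + t *: v) 0 k) = (fun t => P 0 k + t * v 0 k).
  by apply/funext => t; rewrite !mxE.
have h := is_derive_mul_fun (is_derive_id (0 : R) (1 : R)) (is_derive_cst (v 0 k) (0 : R) 1).
apply: (is_derive_eq (is_derive_add_fun (is_derive_cst (P 0 k) (0 : R) 1) h)).
by rewrite mulr0 mulr1 !add0r.
Qed.

Lemma spear_curve_derivable N (P v : 'rV[R]_N) k :
  derivable (fun t : R => spear_pos (P + t *: v) k) 0 1.
Proof.
apply/derivable_mxP => i j; rewrite /spear_pos.
have -> : (fun t : R => ((P + t *: v) 0 k *: delta_mx 0 0 : 'rV[R]_3) i j) =
   (fun t => (P + t *: v) 0 k * (delta_mx 0 0 : 'rV[R]_3) i j).
  by apply/funext => t; rewrite !mxE.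
have h := is_derive_mul_fun (derivable_line P v k)
  (is_derive_cst ((delta_mx 0 0 : 'rV[R]_3) i j) (0 : R) 1).
by case: h.
Qed.

Lemma spear_curve_derive N (P v : 'rV[R]_N) k :
  'D_1 (fun t : R => spear_pos (P + t *: v) k 0 0) 0 = v 0 k.
Proof.
have -> : (fun t : R => spear_pos (P + t *: v) k 0 0) = (fun t : R => (P + t *: v) 0 k).
  by apply/funext => t; rewrite spear_pos00.
by have [_] := derivable_line P v k.
Qed.

Definition spear_differential A B a b N (P v : 'rV[R]_N) : R :=
  \sum_(k < N) \sum_(l < N | (l < k)%N)
    pair_force A B a b (P 0 k - P 0 l) * (v 0 k - v 0 l).

Lemma is_derive_spear_energy A B (B0 : R) a b N (P v : 'rV[R]_N) : increasing_coords P ->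
  is_derive (0 : R) 1 (fun t => spear_energy A B B0 a b (P + t *: v))
    (spear_differential A B a b P v).
Proof.
move=> Pinc.
have := @is_derive_energy A B B0 a b N P (fun t => spear_pos (P + t *: v))
  (fun=> @spear_mom R N) Pinc _ erefl.
rewrite scale0r addr0 => /(_ erefl).
have conf : \forall t \near (0 : R), configuration (spear_pos (P + t *: v)) (@spear_mom R N).
  by apply: filterS (increasing_coords_near v Pinc) => t /spear_configuration.
move=> /(_ conf) h; apply: is_derive_eq.
  apply: h => k; split; [exact: spear_curve_derivable|exact: derivable_cst].
apply: eq_bigr => k _; apply: eq_bigr => l _.
by rewrite !spear_curve_derive.
Qed.

(** Straight lines of spears are admissible curves, which gives one direction. Conversely the
    derivative along any admissible curve depends only on its axial velocities, and these form a
    test vector v. *)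
Lemma critical_spearP A B (B0 : R) a b N (P : 'rV[R]_N) :
  critical_spear A B B0 a b P <->
  increasing_coords P /\ forall v, spear_differential A B a b P v = 0.
Proof.
split=> -[Pinc crit]; split=> //.
  move=> v; have [_ dE] := is_derive_spear_energy A B B0 a b v Pinc.
  rewrite -dE.
  have [] := crit.2 (fun t => spear_pos (P + t *: v)) (fun=> @spear_mom R N).
  - by rewrite scale0r addr0.
  - by [].
  - by apply: filterS (increasing_coords_near v Pinc) => t /spear_configuration.
  - by move=> k; split; [exact: spear_curve_derivable|exact: derivable_cst].
  - by [].
split; first exact: spear_configuration.
move=> Xt Mt X0 M0 conf dXM.
have h := is_derive_energy A B B0 a b Pinc X0 M0 conf dXM.
apply: (is_derive_eq h).
rewrite -[RHS](crit (\row_k 'D_1 (fun t => Xt t k 0 0) 0)).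
by apply: eq_bigr => k _; apply: eq_bigr => l _; rewrite !mxE.
Qed.

(** Along each line of spears the energy has an interior minimum at P, so its derivative vanishes
    there. By [critical_spearP] this covers the variations leaving the axis as well. *)
Lemma minimizing_critical_spear A B (B0 : R) a b N (P : 'rV[R]_N) :
  minimizing_spear A B B0 a b P -> critical_spear A B B0 a b P.
Proof.
move=> [Pinc Pmin]; apply/critical_spearP; split=> // v.
have /nbhs_ballP[e /= e0 he] := increasing_coords_near v Pinc.
have inc t : t \in `]-e, e[%R -> increasing_coords (P + t *: v).
  rewrite in_itv/= => te; apply: he; rewrite /ball/= sub0r normrN.
  by rewrite ltr_norml.
have [_ <-] := is_derive_spear_energy A B B0 a b v Pinc.
have [] := @derive1_at_min R (fun t => spear_energy A B B0 a b (P + t *: v)) (- e) e 0.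
- by lra.
- move=> t /inc Ptinc; apply/derivable1P.
  (* Differentiability at time t is differentiability at time 0 of the line restarted from P + t
     v. *)
  have -> : (fun h : R => spear_energy A B B0 a b (P + (h *: 1 + t) *: v)) =
      (fun h : R => spear_energy A B B0 a b (P + t *: v + h *: v)).
    apply/funext => h; congr (spear_energy A B B0 a b _).
    rewrite -addrA -scalerDl [t + h]addrC.
    by congr (P + (_ + t) *: v); exact: mulr1.
  by have [] := is_derive_spear_energy A B B0 a b v Ptinc.
- by rewrite in_itv/= oppr_lt0 e0.
- by move=> t /inc Ptinc; rewrite scale0r addr0; exact: Pmin.
- by [].
Qed.

(* Extension by the junk value 0 beyond the last coordinate. *)
Definition row_fun N (P : 'rV[R]_N) (i : nat) : R :=
  if insub i is Some j then P 0 j else 0.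

Lemma row_funE N (P : 'rV[R]_N) (i : 'I_N) : row_fun P i = P 0 i.
Proof. by rewrite /row_fun valK. Qed.

Lemma critical_spear_equilibrium A B (B0 : R) a b N (P : 'rV[R]_N) :
  critical_spear A B B0 a b P -> equilibrium (pair_force A B a b) N (row_fun P).
Proof.
move=> /critical_spearP[_ crit] v; rewrite -[RHS](crit (\row_k v k)).
apply: eq_bigr => k _; apply: eq_bigr => l _.
by rewrite !row_funE !mxE.
Qed.

Lemma row_fun_gap N (P : 'rV[R]_N) (i k : 'I_N) : k = i.+1 :> nat ->
  gap (row_fun P) i = P 0 k - P 0 i.
Proof. by move=> ki; rewrite /gap -ki !row_funE. Qed.

Lemma row_fun_gap_gt0 N (P : 'rV[R]_N) l : increasing_coords P ->
  (l.+1 < N)%N -> 0 < gap (row_fun P) l.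
Proof.
move=> Pinc lN; rewrite (@row_fun_gap _ _ (Ordinal (ltnW lN)) (Ordinal lN))//.
by rewrite subr_gt0 Pinc.
Qed.

End CriticalSpears.

(** * Existence of a minimizing spear *)

Section Existence.
Context {R : realType}.
Implicit Types (A B a b x y h : R) (g : nat -> R).

Definition pair_potential A B a b x : R := A * x `^ (- a) - B * x `^ (- b).

(* As a function of x ^ (- b) the potential is convex. *)
Lemma pair_potential_tangent A B a b x y : 0 < A -> 0 < b -> b < a -> 0 < x -> 0 < y ->
  pair_potential A B a b x +
    (a * A / b * x `^ (- (a - b)) - B) * (y `^ (- b) - x `^ (- b))
  <= pair_potential A B a b y.
Proof.
move=> A0 b0 ba x0 y0.
have b00 : b != 0 by rewrite gt_eqF.
have s1 : 1 <= a / b by rewrite ler_pdivlMr// mul1r ltW.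
have := @powR_tangent _ (y `^ (- b)) (x `^ (- b)) (a / b).
rewrite !powR_gt0// s1 orbT => /(_ isT isT isT); rewrite -!powRrM.
rewrite (_ : - b * (a / b) = - a); last by field.
rewrite (_ : - b * (a / b - 1) = - (a - b)); last by field.
rewrite -(ler_pM2l A0) /pair_potential => h.
rewrite -lerBrDl -subr_ge0.
move: h; rewrite -subr_ge0; congr (0 <= _); ring.
Qed.

Lemma h_hat_gt0 A B a b : 0 < A -> 0 < B -> 0 < b -> b < a -> 0 < h_hat A B a b.
Proof.
by move=> A0 B0 b0 ba; rewrite powR_gt0// divr_gt0// mulr_gt0//; apply: lt_trans ba.
Qed.

(** This says that the slope in [pair_potential_tangent] vanishes at [h_hat], the bottom of the
    two-particle well. *)
Lemma h_hat_powR A B a b : 0 < A -> 0 < B -> 0 < b -> b < a ->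
  a * A / b * h_hat A B a b `^ (- (a - b)) = B.
Proof.
move=> A0 B0 b0 ba; have a0 : 0 < a := lt_trans b0 ba.
have ab0 : a - b != 0 by rewrite subr_eq0 gt_eqF.
rewrite -powRrM (_ : 1 / (a - b) * - (a - b) = - 1); last by field.
rewrite powR_inv1; last by rewrite divr_ge0// mulr_ge0// ltW.
by field; rewrite !gt_eqF.
Qed.

Lemma pair_potential_min A B a b y : 0 < A -> 0 < B -> 0 < b -> b < a -> 0 < y ->
  pair_potential A B a b (h_hat A B a b) <= pair_potential A B a b y.
Proof.
move=> A0 B0 b0 ba y0.
have := pair_potential_tangent B A0 b0 ba (h_hat_gt0 A0 B0 b0 ba) y0.
by rewrite h_hat_powR// subrr mul0r addr0.
Qed.

Lemma pair_potential_nondecreasing A B a b x y : 0 < A -> 0 < B -> 0 < b -> b < a ->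
  h_hat A B a b <= x -> x <= y -> pair_potential A B a b x <= pair_potential A B a b y.
Proof.
move=> A0 B0 b0 ba hx xy; have h0 := h_hat_gt0 A0 B0 b0 ba.
have x0 := lt_le_trans h0 hx; have y0 := lt_le_trans x0 xy.
apply: le_trans (pair_potential_tangent B A0 b0 ba x0 y0).
rewrite lerDl -mulrNN mulr_ge0// oppr_ge0 subr_le0; last exact: ler_powRN (ltW b0).
rewrite -[leRHS](h_hat_powR A0 B0 b0 ba) ler_wpM2l//.
  by rewrite divr_ge0 ?mulr_ge0 ?ltW//; exact: lt_trans ba.
by apply: ler_powRN => //; rewrite subr_ge0 ltW.
Qed.

Lemma pair_potential_coercive A B a b (K : R) : 0 < A -> 0 < B -> 0 < b -> b < a ->
  exists2 e, 0 < e & forall x, 0 < x -> x < e -> K < pair_potential A B a b x.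
Proof.
move=> A0 B0 b0 ba.
have d0 : 0 < a - b by rewrite subr_gt0.
(* When x^(b-a) >= z1 the potential is at least x^(-b), and when x^(-b) >= z2 the latter exceeds
   K. *)
pose z1 := (B + 1) / A; have z10 : 0 < z1 by rewrite divr_gt0// addr_gt0.
pose z2 := `|K| + 1; have z20 : 0 < z2 by rewrite ltr_wpDl.
pose e1 := z1 `^ (- (a - b)^-1); pose e2 := z2 `^ (- b^-1).
have e1E : e1 `^ (- (a - b)) = z1.
  rewrite -powRrM (_ : _ * _ = 1); first by rewrite powRr1// ltW.
  by rewrite mulrNN mulVf// gt_eqF.
have e2E : e2 `^ (- b) = z2.
  rewrite -powRrM (_ : _ * _ = 1); first by rewrite powRr1// ltW.
  by rewrite mulrNN mulVf// gt_eqF.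
exists (Num.min e1 e2); first by rewrite lt_min !powR_gt0.
move=> x x0; rewrite lt_min => /andP[xe1 xe2].
have x1 : z1 <= x `^ (- (a - b)) by rewrite -e1E ler_powRN// ltW.
have x2 : z2 <= x `^ (- b) by rewrite -e2E ler_powRN// ltW.
have Kz2 : K < z2 by rewrite /z2 (le_lt_trans (ler_norm K))// ltrDl.
apply: (lt_le_trans Kz2); apply: (le_trans x2).
rewrite /pair_potential (_ : - a = - b + - (a - b)); last ring.
rewrite powRD_gt0//; set X := x `^ (- b); set Y := x `^ _ in x1 *.
have X0 : 0 <= X := powR_ge0 _ _.
have AY : B + 1 <= A * Y by move: x1; rewrite /z1 ler_pdivrMr// mulrC.
rewrite -subr_ge0 (_ : _ - _ = X * (A * Y - (B + 1))); last by ring.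
by rewrite mulr_ge0// subr_ge0.
Qed.

Lemma spear_energyE A B (B0 : R) a b N (P : 'rV[R]_N) : increasing_coords P ->
  spear_energy A B B0 a b P =
  \sum_(k < N) \sum_(l < N | (l < k)%N) pair_potential A B a b (P 0 k - P 0 l).
Proof.
move=> Pinc; apply: eq_bigr => k _; apply: eq_bigr => l lk.
have x0 : 0 < P 0 k - P 0 l by rewrite subr_gt0 Pinc.
rewrite /pair_energy spear_posB /spear_mom; set x := P 0 k - P 0 l in x0 *.
have dmm : dot (delta_mx 0 0 : 'rV[R]_3) (delta_mx 0 0) = 1.
  by rewrite -[delta_mx 0 0]scale1r dot_axis mulr1.
have dmr : dot (delta_mx 0 0) (x *: delta_mx 0 0 : 'rV[R]_3) = x.
  by rewrite -[X in dot X _]scale1r dot_axis mul1r.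
rewrite dmm dmr enorm_axis gtr0_norm//.
rewrite /pair_potential (powRD_gt0 _ _ x0) powR_mulrn ?(ltW x0)// !powRN.
have := powR_gt0 b x0; have := powR_gt0 a x0.
set Xa := x `^ a; set Xb := x `^ b => Xa0 Xb0.
by field; rewrite !gt_eqF.
Qed.

(** Placing the first particle at 0 removes the translations, the only obstruction to compactness
    once the gaps are bounded. *)
Definition chain_of g N : 'rV[R]_N := \row_(k < N) \sum_(0 <= l < k) g l.

Lemma chain_ofB g N (k l : 'I_N) : (l <= k)%N ->
  chain_of g N 0 k - chain_of g N 0 l = \sum_(l <= m < k) g m.
Proof.
by move=> lk; rewrite !mxE [X in X - _](big_cat_nat (n := l))//= addrAC subrr add0r.
Qed.

Lemma chain_of_increasing g N : (forall l, (l.+1 < N)%N -> 0 < g l) ->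
  increasing_coords (chain_of g N).
Proof.
move=> g0 l k lk; rewrite -subr_gt0 chain_ofB 1?ltnW// big_ltn//.
rewrite ltr_wpDr ?g0//; last exact: leq_ltn_trans lk (ltn_ord k).
rewrite big_nat_cond sumr_ge0// => m /andP[/andP[_ mk] _]; apply/ltW/g0.
exact: leq_ltn_trans mk (ltn_ord k).
Qed.

Lemma continuous_pair_potential A B a b x : 0 < x ->
  {for x, continuous (pair_potential A B a b)}.
Proof.
move=> x0; have cp (s : R) : {for x, continuous (fun y : R => y `^ s)}.
  apply/differentiable_continuous/derivable1_diffP.
  by have [] := is_derive1_powR s x0.
by apply: cvgB; apply: cvgM; [exact: cvg_cst|exact: cp|exact: cvg_cst|exact: cp].
Qed.

Lemma continuous_chain_potential A B a b N (G : 'rV[R]_N) : (forall l, 0 < G 0 l) ->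
  {for G, continuous (fun G : 'rV[R]_N =>
    \sum_(k < N) \sum_(l < N | (l < k)%N)
      pair_potential A B a b (\sum_(i < N | (l <= i < k)%N) G 0 i))}.
Proof.
move=> G0; have add_cont := @add_continuous R.
apply: (@cvg_big _ _ +%R 0 xpredT add_cont _ (nbhs G)) => k _.
apply: (@cvg_big _ _ +%R 0 (fun l : 'I_N => (l < k)%N) add_cont _ (nbhs G)) => l lk.
apply: (@continuous_comp _ _ _ (fun G : 'rV[R]_N => \sum_(i < N | (l <= i < k)%N) G 0 i)
  (pair_potential A B a b)).
  apply: (@cvg_big _ _ +%R 0 (fun i : 'I_N => (l <= i < k)%N) add_cont _ (nbhs G)) => i _.
  exact: coord_continuous.
apply: continuous_pair_potential.
rewrite (bigD1 l)/=; last by rewrite leqnn.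
by rewrite ltr_wpDr// sumr_ge0// => i _; exact: ltW.
Qed.

Lemma sum_ord_window (g : nat -> R) N (l k : nat) : (l <= k)%N -> (k <= N)%N ->
  \sum_(i < N | (l <= i < k)%N) g i = \sum_(l <= i < k) g i.
Proof.
move=> lk kN; rewrite -(big_mkord (fun i => (l <= i < k)%N) g).
rewrite (big_cat_nat (n := l))//=; last exact: leq_trans kN.
rewrite [X in X + _]big_nat_cond [X in X + _]big_pred0 ?add0r; last by move=> i; lia.
rewrite (big_cat_nat (n := k))//=.
rewrite [X in _ + X]big_nat_cond [X in _ + X]big_pred0 ?addr0; last by move=> i; lia.
rewrite big_nat_cond [RHS]big_nat_cond; apply: eq_bigl => i; lia.
Qed.

(** The energy, as a function of the gaps, attains a minimum on the box of gaps in [e, [h_hat]]. A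
    chain with a gap below e costs more than the uniform chain of spacing [h_hat], and cutting
    longer gaps down to [h_hat] does not raise the energy, so this minimum is global. *)
Lemma exists_minimizing_spear A B (B0 : R) a b N :
  0 < A -> 0 < B -> 0 < b -> b < a -> (0 < N)%N ->
  exists P : 'rV[R]_N, minimizing_spear A B B0 a b P.
Proof.
move=> A0 B00 b0 ba N0.
have arith (x y z u v : R) : x - y + z < u -> u - z <= v - y -> x <= v by lra.
set f := pair_potential A B a b; set H := h_hat A B a b.
have H0 : 0 < H := h_hat_gt0 A0 B00 b0 ba.
have fmin y : 0 < y -> f H <= f y by exact: pair_potential_min.
pose P1 := chain_of (fun=> H) N.
have P1inc : increasing_coords P1 by exact: chain_of_increasing.
pose S := \sum_(k < N) \sum_(l < N | (l < k)%N) f H.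
(* Every pair contributes at least f H and S is this bound summed over all pairs, so one pair above
   this level brings the total above the energy of P1. *)
have [e0 e00 he0] := pair_potential_coercive
  (spear_energy A B B0 a b P1 - S + f H) A0 B00 b0 ba.
pose e := Num.min e0 H.
have e_gt0 : 0 < e by rewrite lt_min e00.
have eH : e <= H by rewrite ge_min lexx orbT.
pose box := [set G : 'rV[R]_N | forall i, `[e, H]%classic (G 0 i)]%classic.
pose F (G : 'rV[R]_N) := \sum_(k < N) \sum_(l < N | (l < k)%N)
      f (\sum_(i < N | (l <= i < k)%N) G 0 i).
have boxP G : box G <-> forall i, e <= G 0 i <= H.
  by split=> h i; have := h i; rewrite /= in_itv.
have cbox : compact box.
  by apply: (@rV_compact _ _ (fun=> `[e, H]%classic)) => i; exact: segment_compact.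
have box1 : box (const_mx H) by apply/boxP => i; rewrite mxE eH lexx.
have cF : {within box, continuous F}%classic.
  apply: continuous_in_subspaceT => G /set_mem/boxP hG.
  apply: continuous_chain_potential => l; have /andP[eG _] := hG l.
  exact: lt_le_trans e_gt0 eG.
have [G /set_mem/boxP hG Gmin] := compact_EVT_min (ex_intro _ _ box1) cbox cF.
have FE (g : nat -> R) : (forall l, (l < N)%N -> 0 < g l) ->
    spear_energy A B B0 a b (chain_of g N) = F (\row_i g i).
  move=> g0; rewrite spear_energyE; last first.
    by apply: chain_of_increasing => l /ltnW; exact: g0.
  apply: eq_bigr => k _; apply: eq_bigr => l lk.
  rewrite chain_ofB 1?ltnW//; congr (f _).
  rewrite -(sum_ord_window g (ltnW lk) (ltnW (ltn_ord k))).
  by apply: eq_bigr => i _; rewrite mxE.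
have Ggt0 l : (l < N)%N -> 0 < row_fun G l.
  move=> lN; rewrite (row_funE G (Ordinal lN)); have /andP[eG _] := hG (Ordinal lN).
  exact: lt_le_trans e_gt0 eG.
exists (chain_of (row_fun G) N); split.
  by apply: chain_of_increasing => l /ltnW; exact: Ggt0.
move=> Q Qinc; rewrite FE//.
have -> : \row_i row_fun G i = G by apply/rowP => i; rewrite mxE row_funE.
have Fbox G' : box G' -> F G <= F G' by move=> hG'; apply: Gmin; exact: mem_set.
have [[l [lN gl]]|no_small] := pselect (exists l, (l.+1 < N)%N /\ gap (row_fun Q) l < e).
  apply: (@le_trans _ _ (spear_energy A B B0 a b P1)).
    rewrite FE//; apply: Fbox; apply/boxP => i; rewrite mxE eH lexx//.
  pose i := Ordinal (ltnW lN); pose k := Ordinal lN.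
  have fgap : spear_energy A B B0 a b P1 - S + f H < f (Q 0 k - Q 0 i).
    rewrite -row_fun_gap//; apply: he0; first exact: row_fun_gap_gt0.
    by apply: lt_le_trans gl _; rewrite ge_min lexx.
  rewrite [leRHS]spear_energyE//; apply: arith fgap _.
  have pos (k' l' : 'I_N) : (l' < k')%N -> 0 <= f (Q 0 k' - Q 0 l') - f H.
    by move=> lk; rewrite subr_ge0 fmin// subr_gt0 Qinc.
  have -> : \sum_(k < N) \sum_(l < N | (l < k)%N) f (Q 0 k - Q 0 l) - S =
     \sum_(k < N) \sum_(l < N | (l < k)%N) (f (Q 0 k - Q 0 l) - f H).
    by rewrite /S -sumrB; apply: eq_bigr => k' _; rewrite -sumrB.
  rewrite (bigD1 k)//= (bigD1 i)//= -addrA lerDl addr_ge0// ?sumr_ge0//.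
    by move=> l' /andP[lk _]; exact: pos.
  by move=> k' _; apply: sumr_ge0 => l'; exact: pos.
have Qgap l : (l.+1 < N)%N -> e <= gap (row_fun Q) l.
  by move=> lN; rewrite leNgt; apply/negP => gl; apply: no_small; exists l.
(* The row has N entries for N - 1 gaps; the value H keeps the last entry in the box. *)
pose g l := if (l.+1 < N)%N then Num.min (gap (row_fun Q) l) H else H.
have hg l : e <= g l <= H.
  rewrite /g; case: ifP => lN; last by rewrite eH lexx.
  by rewrite le_min eH Qgap//= ge_min lexx orbT.
have g0 l : (l < N)%N -> 0 < g l.
  by move=> _; have /andP[eg _] := hg l; exact: lt_le_trans e_gt0 eg.
apply: (@le_trans _ _ (F (\row_i g i))).
  by apply: Fbox; apply/boxP => i; rewrite mxE.
have ginc : increasing_coords (chain_of g N).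
  by apply: chain_of_increasing => l /ltnW; exact: g0.
rewrite -(FE g g0) (spear_energyE A B B0 a b ginc) (spear_energyE A B B0 a b Qinc).
apply: ler_sum => k _; apply: ler_sum => l lk.
rewrite chain_ofB 1?ltnW//.
have Qkl : Q 0 k - Q 0 l = \sum_(l <= m < k) gap (row_fun Q) m.
  by rewrite -gap_sum 1?ltnW// !row_funE.
have le_gap : \sum_(l <= m < k) g m <= Q 0 k - Q 0 l.
  rewrite Qkl [leLHS]big_nat_cond [leRHS]big_nat_cond.
  apply: ler_sum => m /andP[/andP[_ mk] _].
  by rewrite /g (leq_ltn_trans mk)// ge_min lexx.
(* Either no gap between the two particles was cut and their distance is unchanged, or one was cut
   and the new distance is still at least H, where the potential is nondecreasing. *)
have [small|] := pselect (forall m, (l <= m < k)%N -> gap (row_fun Q) m <= H).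
  suff -> : \sum_(l <= m < k) g m = Q 0 k - Q 0 l by [].
  rewrite Qkl; apply: eq_big_nat => m mlk.
  have /andP[_ mk] := mlk.
  by rewrite /g (leq_ltn_trans mk)//; apply/min_idPl; exact: small.
move=> /existsNP[m /not_implyP[/andP[lm mk]] /negP]; rewrite -ltNge => Hm.
apply: pair_potential_nondecreasing => //.
rewrite (big_cat_nat (n := m))//=; last exact: ltnW.
rewrite [X in _ + X]big_ltn// {2}/g (leq_ltn_trans mk)//.
rewrite [Num.min _ _]min_r ?(ltW Hm)//.
have g_ge0 j : 0 <= g j by have /andP[eg _] := hg j; exact: le_trans (ltW e_gt0) eg.
by rewrite addrCA lerDl addr_ge0// sumr_ge0.
Qed.

End Existence.

(** * Rescaling by [h_hat] and the threshold on alpha *)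

Section Normalisation.
Context {R : realType}.
Implicit Types (A B a b x : R).

Lemma powR_root x d : 0 < x -> 0 < d -> (x `^ (1 / d)) `^ d = x.
Proof. by move=> x0 d0; rewrite -powRrM div1r mulVf ?gt_eqF// powRr1// ltW. Qed.

Lemma powR_root_le x h d : 0 < x -> 0 < h -> 0 < d -> x <= h `^ d -> x `^ (1 / d) <= h.
Proof.
move=> x0 h0 d0 xh.
have hE : h = (h `^ d) `^ (1 / d) by rewrite -powRrM div1r mulfV ?gt_eqF// powRr1// ltW.
rewrite [leRHS]hE; apply: ge0_ler_powR => //.
- by rewrite divr_ge0// ltW.
- by rewrite nnegrE ltW.
- by rewrite nnegrE powR_ge0.
Qed.

(* The bounds h_check and h_bar when alpha * A = beta * B, that is, in units of
   h_hat. *)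
Definition unit_check a b : R := (zeta b)^-1 `^ (1 / (a - b)).
Definition unit_bar a b : R := (zeta a / zeta b) `^ (1 / (a - b)).

Lemma h_checkE A B a b : 0 < A -> 0 < B -> 1 < b -> b < a ->
  h_check A B a b = h_hat A B a b * unit_check a b.
Proof.
move=> A0 B0 b1 ba; have z0 := zeta_gt0 b1.
have b0 : 0 < b := lt_trans ltr01 b1; have a0 : 0 < a := lt_trans b0 ba.
rewrite /h_check /h_hat /unit_check -powRM; last 2 first.
- by rewrite divr_ge0// mulr_ge0// ltW.
- by rewrite invr_ge0 ltW.
by congr (_ `^ _); rewrite [in LHS]invfM mulrA.
Qed.

Lemma h_barE A B a b : 0 < A -> 0 < B -> 1 < b -> b < a ->
  h_bar A B a b = h_hat A B a b * unit_bar a b.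
Proof.
move=> A0 B0 b1 ba; have z0 := zeta_gt0 b1; have za0 := zeta_gt0 (lt_trans b1 ba).
have b0 : 0 < b := lt_trans ltr01 b1; have a0 : 0 < a := lt_trans b0 ba.
rewrite /h_bar /h_hat /unit_bar -powRM; last 2 first.
- by rewrite divr_ge0// mulr_ge0// ltW.
- by rewrite divr_ge0// ltW.
by congr (_ `^ _); rewrite [in LHS]invfM mulrACA.
Qed.

(** By the definition of [h_hat], a A = b B h_hat^(a-b), so in units of [h_hat] both powers carry
    the same coefficient. *)
Lemma pair_force_scale A B a b x : 0 < A -> 0 < B -> 1 < b -> b < a -> 0 < x ->
  pair_force A B a b x =
  b * B * h_hat A B a b `^ (- (b + 1)) * force a b (x / h_hat A B a b).
Proof.
move=> A0 B0 b1 ba x0; have b0 : 0 < b := lt_trans ltr01 b1.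
have H0 := h_hat_gt0 A0 B0 b0 ba; have HB := h_hat_powR A0 B0 b0 ba.
set H := h_hat A B a b in H0 HB *.
have scale s : (x / H) `^ (- s) = x `^ (- s) * H `^ s.
  rewrite powRM ?invr_ge0 ?(ltW x0) ?(ltW H0)//; congr (_ * _).
  by rewrite -(powR_inv1 (ltW H0)) -powRrM mulN1r opprK.
rewrite /force !scale mulrBr /pair_force; congr (_ - _).
  rewrite [RHS](_ : _ =
    b * B * x `^ (- (b + 1)) * (H `^ (b + 1) * H `^ (- (b + 1)))); last ring.
  by rewrite powRMN// mulr1.
have aE : a * A = b * B * H `^ (a - b).
  rewrite -HB; have := powRMN (a - b) H0.
  set X := H `^ (a - b); set Y := H `^ _ => XY.
  rewrite (_ : b * _ * _ = a * A * (X * Y)); last by field; rewrite gt_eqF.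
  by rewrite XY mulr1.
rewrite aE (_ : a - b = - (b + 1) + (a + 1)); last ring.
by rewrite (@powRD_gt0 _ _ (- (b + 1)))//; ring.
Qed.

Definition normalised A B a b N (P : 'rV[R]_N) (i : nat) : R :=
  row_fun P i / h_hat A B a b.

Lemma gap_normalised A B a b N (P : 'rV[R]_N) i :
  gap (normalised A B a b P) i = gap (row_fun P) i / h_hat A B a b.
Proof. by rewrite /gap -mulrBl. Qed.

Lemma normalised_equilibrium A B (B0 : R) a b N (P : 'rV[R]_N) :
  0 < A -> 0 < B -> 1 < b -> b < a -> critical_spear A B B0 a b P ->
  equilibrium (force a b) N (normalised A B a b P).
Proof.
move=> A0 B00 b1 ba crit v; have b0 : 0 < b := lt_trans ltr01 b1.
have H0 := h_hat_gt0 A0 B00 b0 ba.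
have [Pinc _] := crit.
have := critical_spear_equilibrium crit v.
have -> : \sum_(k < N) \sum_(l < N | (l < k)%N)
    pair_force A B a b (row_fun P k - row_fun P l) * (v k - v l) =
  b * B * h_hat A B a b `^ (- (b + 1)) * \sum_(k < N) \sum_(l < N | (l < k)%N)
    force a b (normalised A B a b P k - normalised A B a b P l) * (v k - v l).
  rewrite mulr_sumr; apply: eq_bigr => k _; rewrite mulr_sumr; apply: eq_bigr => l lk.
  rewrite pair_force_scale//; last by rewrite !row_funE subr_gt0 Pinc.
  by rewrite -mulrA -mulrBl.
move/eqP; rewrite mulf_eq0 => /orP[|/eqP//].
by rewrite gt_eqF// !mulr_gt0// powR_gt0.
Qed.

Lemma normalised_gap_gt0 A B a b N (P : 'rV[R]_N) l :
  0 < A -> 0 < B -> 0 < b -> b < a -> increasing_coords P ->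
  (l.+1 < N)%N -> 0 < gap (normalised A B a b P) l.
Proof.
move=> A0 B0 b0 ba Pinc lN; rewrite gap_normalised divr_gt0 ?h_hat_gt0//.
exact: row_fun_gap_gt0.
Qed.

Lemma normalised_gap_bounds A B (B0 : R) a b N (P : 'rV[R]_N) l :
  0 < A -> 0 < B -> 1 < b -> b < a -> critical_spear A B B0 a b P ->
  (l.+1 < N)%N -> unit_check a b <= gap (normalised A B a b P) l <= 1.
Proof.
move=> A0 B00 b1 ba crit lN; have b0 : 0 < b := lt_trans ltr01 b1.
have eqn := normalised_equilibrium A0 B00 b1 ba crit.
have gap0 m := @normalised_gap_gt0 A B a b N P m A0 B00 b0 ba crit.1.
rewrite (gap_le1 gap0 eqn b1 ba lN) andbT.
have [m mN' mmin] := @exists_argmin _ (gap (normalised A B a b P)) N.-1 ltac:(nat_lia).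
have mN : (m.+1 < N)%N by nat_lia.
have hmin j : (j.+1 < N)%N -> gap (normalised A B a b P) m <= gap (normalised A B a b P) j.
  by move=> jN; apply: mmin; nat_lia.
apply: le_trans (hmin l lN).
have := min_gap_ge gap0 eqn b1 ba mN erefl hmin.
have z0 := zeta_gt0 b1.
rewrite -ler_pdivrMl// mulr1 => h.
by apply: powR_root_le; [rewrite invr_gt0|exact: gap0|rewrite subr_gt0|exact: h].
Qed.

Lemma enorm_gap N (P : 'rV[R]_N) (i k : 'I_N) : increasing_coords P ->
  k = i.+1 :> nat -> enorm (spear_pos P i - spear_pos P k) = gap (row_fun P) i.
Proof.
move=> Pinc ki; rewrite spear_posB enorm_axis distrC (row_fun_gap P ki) gtr0_norm//.
by rewrite subr_gt0 Pinc// ki.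
Qed.

(** A sum of positive terms, so that exceeding it gives every largeness condition used above at
    once; see [alpha_threshold_lt]. *)
Definition alpha_threshold b : R := 2 * b + 2 + 2 * zeta b +
  (b + 1) * zeta b * (1 + zeta 2 * (2 `^ (b - 1) * (1 + zeta (b - 1)))).

Lemma unit_check_gt0 a b : 1 < b -> 0 < unit_check a b.
Proof. by move=> b1; rewrite powR_gt0// invr_gt0 zeta_gt0. Qed.

(** The left-hand side is zeta b to the power (b + 2) / (a - b), which is at most 1, and zeta b >=
    1. *)
Lemma unit_check_powRN a b : 1 < b -> 2 * b + 2 <= a ->
  unit_check a b `^ (- (b + 2)) <= zeta b.
Proof.
move=> b1 ab; have z0 := zeta_gt0 b1; have z1 := zeta_ge1 b1.
rewrite /unit_check -(powR_inv1 (ltW z0)) -!powRrM.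
rewrite -[leRHS](powRr1 (ltW z0)); apply: ler_powR => //.
have d0 : 0 < a - b by lra.
rewrite [leLHS](_ : _ = (b + 2) / (a - b)); last by field; rewrite gt_eqF.
by rewrite ler_pdivrMr//; lra.
Qed.

(* With d = a - b this follows from 2 ^ d >= (1 + d / 2) ^ 2. *)
Lemma unit_check_far a b : 1 < b -> 2 * b + 2 <= a -> 2 * zeta b <= a - b ->
  (a + 1) / (b + 1) * (2 * unit_check a b) `^ (- (a - b)) <= 1.
Proof.
move=> b1 ab zd; have z0 := zeta_gt0 b1.
have d0 : 0 < a - b by lra.
have c0 := @unit_check_gt0 a b b1.
have cE : unit_check a b `^ (- (a - b)) = zeta b.
  by rewrite powRN powR_root ?invr_gt0// invrK.
rewrite powRM ?(ltW c0)// cE.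
move: (zeta b) z0 zd {cE c0} => z z0 zd.
have half : 1 + (a - b) / 2 <= 2 `^ ((a - b) / 2).
  have := @bernoulli_powR R 2 ((a - b) / 2) ltac:(lra).
  rewrite (_ : 1 <= (a - b) / 2) ?orbT; last lra.
  by move=> /(_ isT); lra.
have two : 2 `^ (a - b) = 2 `^ ((a - b) / 2) * 2 `^ ((a - b) / 2).
  by rewrite -powRD_gt0//; congr powR; field.
have X0 := @powR_gt0 R 2 (a - b) ltac:(lra).
rewrite powRN mulrCA ler_pdivrMl// mulr1 two.
move: half; set X := 2 `^ _ => half.
have s_le : (a + 1) / (b + 1) <= 1 + (a - b) / 2.
  by rewrite ler_pdivrMr; nra.
apply: (@le_trans _ _ ((1 + (a - b) / 2) * (1 + (a - b) / 2))).
  by apply: ler_pM => //; [rewrite divr_ge0; lra|lra|lra].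
by apply: ler_pM => //; lra.
Qed.

Lemma alpha_threshold_lt a b : 3 <= b -> alpha_threshold b < a ->
  [/\ 2 * b + 2 <= a, 2 * zeta b <= a - b,
     (b + 1) * zeta b * (1 + zeta 2) < a + 1 &
     1 + (b + 1) * zeta b * (1 + zeta 2 * (2 `^ (b - 1) * (1 + zeta (b - 1)))) <= a + 1].
Proof.
move=> b3; rewrite /alpha_threshold.
have z0 := @zeta_gt0 R b ltac:(lra); have z20 := @zeta_gt0 R 2 ltac:(lra).
have zq0 := @zeta_gt0 R (b - 1) ltac:(lra).
have p1 : (1 : R) <= 2 `^ (b - 1) by rewrite -[leLHS](powRr0 2) ler_powR//; lra.
have K1 : 1 <= 2 `^ (b - 1) * (1 + zeta (b - 1)).
  rewrite -[leLHS]mulr1; apply: ler_pM => //; lra.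
move: (2 `^ (b - 1) * _) K1 {zq0 p1} => K K1.
move: (zeta b) (zeta 2) z0 z20 => z z2 z0 z20.
have k0 : 0 < (b + 1) * z by rewrite mulr_gt0//; lra.
have zK : (b + 1) * z * (1 + z2) <= (b + 1) * z * (1 + z2 * K).
  by rewrite ler_wpM2l ?(ltW k0)// lerD2l ler_peMr// ltW.
have k0' : 0 < (b + 1) * z * (1 + z2) by rewrite mulr_gt0//; lra.
by split; lra.
Qed.

Lemma unit_bar_gt0 a b : 1 < b -> b < a -> 0 < unit_bar a b.
Proof.
move=> b1 ba; rewrite powR_gt0// divr_gt0 ?zeta_gt0//; exact: lt_trans ba.
Qed.

Lemma unit_bar_powR a b : 1 < b -> b < a -> unit_bar a b `^ (a - b) * zeta b = zeta a.
Proof.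
move=> b1 ba; have z0 := zeta_gt0 b1; have za0 := zeta_gt0 (lt_trans b1 ba).
by rewrite powR_root ?divr_gt0 ?subr_gt0// divfK// gt_eqF.
Qed.

Lemma unit_check_le_bar a b : 1 < b -> b < a -> unit_check a b <= unit_bar a b.
Proof.
move=> b1 ba; have z0 := zeta_gt0 b1; have za1 := zeta_ge1 (lt_trans b1 ba).
apply: powR_root_le; rewrite ?invr_gt0 ?unit_bar_gt0 ?subr_gt0//.
have := unit_bar_powR b1 ba => /(canRL (mulfK (lt0r_neq0 z0))) ->.
by rewrite ler_peMl// invr_ge0 ltW.
Qed.

(** [equilibrium_gap_le] in both directions makes all gaps equal, so the chains differ by the offset
    of their first particles. *)
Lemma critical_spear_unique A B (B0 : R) a b N (P Q : 'rV[R]_N) :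
  0 < A -> 0 < B -> 3 <= b -> alpha_threshold b < a -> (0 < N)%N ->
  critical_spear A B B0 a b P -> critical_spear A B B0 a b Q ->
  exists lambda : R, Q = P + const_mx lambda.
Proof.
move=> A0 B00 b3 ath N0 cP cQ.
have [ab zd uniq_cond _] := alpha_threshold_lt b3 ath.
have b1 : 1 < b by apply: lt_le_trans b3; rewrite ltr1n.
have b2 : 2 <= b by apply: le_trans b3; rewrite ler_nat.
have ba : b < a.
  by apply: lt_le_trans ab; move: b1; clear; lra.
have H0 := h_hat_gt0 A0 B00 (lt_trans ltr01 b1) ba.
have gap_le (P' Q' : 'rV[R]_N) : critical_spear A B B0 a b P' ->
    critical_spear A B B0 a b Q' -> forall l, (l.+1 < N)%N ->
    gap (row_fun Q') l <= gap (row_fun P') l.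
  move=> cP' cQ' l lN.
  have := equilibrium_gap_le b2 ba (unit_check_gt0 a b1) (unit_check_powRN b1 ab)
    (unit_check_far b1 ab zd) uniq_cond
    (normalised_equilibrium A0 B00 b1 ba cP') (normalised_equilibrium A0 B00 b1 ba cQ')
    (fun m => normalised_gap_bounds A0 B00 b1 ba cP' (l := m))
    (fun m => normalised_gap_bounds A0 B00 b1 ba cQ' (l := m)) lN.
  by rewrite !gap_normalised ler_pM2r// invr_gt0.
pose i0 := Ordinal N0.
exists (Q 0 i0 - P 0 i0); apply/rowP => k; rewrite !mxE.
suff : Q 0 k - Q 0 i0 = P 0 k - P 0 i0.
  by move/(canRL (subrK _)) => ->; rewrite addrAC addrA.
rewrite -!row_funE !gap_sum//; apply: eq_big_nat => l /andP[_ lk].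
have lN : (l.+1 < N)%N by exact: leq_ltn_trans lk (ltn_ord k).
by apply/eqP; rewrite eq_le !gap_le.
Qed.

Lemma critical_spear_gap_ge A B (B0 : R) a b N (P : 'rV[R]_N) l :
  0 < A -> 0 < B -> 3 <= b -> alpha_threshold b < a ->
  critical_spear A B B0 a b P -> (l.+1 < N)%N ->
  unit_bar a b + 2 `^ (- (b + 1)) * unit_check a b `^ (a + 1) / (zeta b * (a - b)) *
    N%:R `^ (- (b - 1)) <= gap (normalised A B a b P) l.
Proof.
move=> A0 B00 b3 ath cP lN.
have [ab zd _ _] := alpha_threshold_lt b3 ath.
have b1 : 1 < b by apply: lt_le_trans b3; rewrite ltr1n.
have ba : b < a by apply: lt_le_trans ab; move: b1; clear; lra.
apply: (gap_ge_hbar b1 ab (unit_check_gt0 a b1) (unit_check_far b1 ab zd)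
  (normalised_equilibrium A0 B00 b1 ba cP)
  (fun m => normalised_gap_bounds A0 B00 b1 ba cP (l := m))
  (unit_bar_gt0 b1 ba) (unit_bar_powR b1 ba)) => //.
Qed.

Lemma critical_spear_gap_le A B (B0 : R) a b N (P : 'rV[R]_N) l :
  0 < A -> 0 < B -> 3 <= b -> alpha_threshold b < a ->
  critical_spear A B B0 a b P -> (l.+1 < N)%N ->
  gap (normalised A B a b P) l <=
  unit_bar a b + unit_bar a b `^ (- (b + 1)) / (b - 1) * weight (b - 1) N l.
Proof.
move=> A0 B00 b3 ath cP lN.
have [ab zd _ K_cond] := alpha_threshold_lt b3 ath.
have b1 : 1 < b by apply: lt_le_trans b3; rewrite ltr1n.
have ba : b < a by apply: lt_le_trans ab; move: b1; clear; lra.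
apply: (gap_le_hbar b3 ab (unit_check_gt0 a b1) (unit_check_powRN b1 ab)
  (unit_check_far b1 ab zd) K_cond (normalised_equilibrium A0 B00 b1 ba cP)
  (unit_check_le_bar b1 ba) (unit_bar_powR b1 ba)) => // m mN.
have /andP[_ ->] := normalised_gap_bounds A0 B00 b1 ba cP mN; rewrite andbT.
(* The lower estimate supplies the hypothesis that no gap is shorter than [unit_bar]. *)
apply: le_trans (critical_spear_gap_ge A0 B00 b3 ath cP mN).
rewrite lerDl mulr_ge0 ?powR_ge0// divr_ge0 ?mulr_ge0 ?powR_ge0//.
  by rewrite ltW// zeta_gt0.
by rewrite subr_ge0 ltW.
Qed.

End Normalisation.

(** * Return to the original units and assembly of the claims *)

Theorem theorem1p1 (R : realType) :
  (forall (A B B0 alpha beta : R) (N : nat),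
     0 < A -> 0 < B -> 0 < B0 -> 1 < beta -> beta < alpha -> (2 <= N)%N ->
     (exists P0 : 'rV[R]_N,
        critical_spear A B B0 alpha beta P0 /\
        minimizing_spear A B B0 alpha beta P0) /\
     (forall P : 'rV[R]_N,
        critical_spear A B B0 alpha beta P ->
        forall i k : 'I_N, k = i.+1 :> nat ->
          h_check A B alpha beta <= enorm (spear_pos P i - spear_pos P k)
            <= h_hat A B alpha beta))
  /\
  (forall beta : R, 3 <= beta ->
   exists alpha_star : R,
   forall A B B0 alpha : R,
     0 < A -> 0 < B -> 0 < B0 -> beta < alpha -> alpha_star < alpha ->
     (forall N : nat, (2 <= N)%N ->
        forall P Q : 'rV[R]_N,
          critical_spear A B B0 alpha beta P ->
          critical_spear A B B0 alpha beta Q ->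
          exists lambda : R, Q = P + const_mx lambda) /\
     (exists c C : R, 0 < c /\ 0 < C /\
        forall (N : nat) (P0 : 'rV[R]_N), (2 <= N)%N ->
          critical_spear A B B0 alpha beta P0 ->
          minimizing_spear A B B0 alpha beta P0 ->
          forall i k : 'I_N, k = i.+1 :> nat ->
            h_bar A B alpha beta + c / N%:R `^ (beta - 1)
              <= enorm (spear_pos P0 i - spear_pos P0 k)
              <= h_bar A B alpha beta
                 + C * (1 / N%:R `^ (beta - 1) + 1 / k%:R `^ (beta - 1)
                        + 1 / (N - k)%:R `^ (beta - 1)))).
Proof.
split=> [A B B0 a b N A0 B00 _ b1 ba N2|b b3].
  have b0 : 0 < b := lt_trans ltr01 b1; have H0 := h_hat_gt0 A0 B00 b0 ba.
  split.
    have [P Pmin] := exists_minimizing_spear B0 A0 B00 b0 ba (ltnW N2).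
    by exists P; split=> //; exact: minimizing_critical_spear.
  move=> P cP i k ki; rewrite (enorm_gap cP.1 ki).
  have iN : (i.+1 < N)%N by rewrite -ki.
  have := normalised_gap_bounds A0 B00 b1 ba cP iN.
  rewrite gap_normalised ler_pdivlMr// ler_pdivrMr// mul1r => /andP[h1 ->].
  by rewrite andbT h_checkE// mulrC.
(* The threshold depends on b alone; the constants [c] and [C] below depend on a and b but not on
   N. *)
exists (alpha_threshold b) => A B B0 a A0 B00 _ ba ath.
have b1 : 1 < b by apply: lt_le_trans b3; rewrite ltr1n.
have b0 : 0 < b := lt_trans ltr01 b1; have H0 := h_hat_gt0 A0 B00 b0 ba.
split=> [N N2 P Q|].
  exact: critical_spear_unique A0 B00 b3 ath (ltnW N2).
set H := h_hat A B a b in H0 *.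
pose c := 2 `^ (- (b + 1)) * unit_check a b `^ (a + 1) / (zeta b * (a - b)).
pose C := unit_bar a b `^ (- (b + 1)) / (b - 1).
have c0 : 0 < c.
  apply: divr_gt0; apply: mulr_gt0; rewrite ?subr_gt0 ?zeta_gt0//.
  by apply: powR_gt0; exact: unit_check_gt0.
have C0 : 0 < C by rewrite divr_gt0 ?subr_gt0// powR_gt0// unit_bar_gt0.
exists (H * c), (H * C); split; first exact: mulr_gt0.
split=> [|N P N2 cP _ i k ki]; first exact: mulr_gt0.
rewrite (enorm_gap cP.1 ki).
have iN : (i.+1 < N)%N by rewrite -ki.
have gapE : gap (row_fun P) i = H * gap (normalised A B a b P) i.
  by rewrite gap_normalised mulrC divfK// gt_eqF.
(* The common factor [h_hat] is cancelled, which leaves the bounds on the normalised gap. *)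
rewrite gapE h_barE// -/H -[H * c / _]mulrA -[H * C * _]mulrA
  -[_ + H * (c / _)]mulrDr -[_ + H * (C * _)]mulrDr !ler_pM2l//.
apply/andP; split.
  by rewrite -powRN; exact: critical_spear_gap_ge A0 B00 b3 ath cP iN.
apply: le_trans (critical_spear_gap_le A0 B00 b3 ath cP iN) _.
(* As k = i + 1, the two terms of the weight are those in k and N - k. *)
rewrite lerD2l -/C ler_pM2l// /weight -ki !powRN !div1r -addrA lerDr.
by rewrite invr_ge0 powR_ge0.
Qed.
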